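(* In the extra-special case, $$\mathcal M_{\Delta(1)}(t)=\prod_{\gamma\in\Delta(1)}\frac{1-t^{\mathrm{ht}(\gamma)+1}}{1-t^{\mathrm{ht}(\gamma)}}.$$
   Context: Let $\mathfrak g$ be a complex simple Lie algebra with root system $\Delta$ in a real Euclidean space with $W$-invariant inner product $(\,,\,)$, simple roots $\Pi$, highest root $\theta$, $\theta^\vee=2\theta/(\theta,\theta)$. For $\gamma\in\Delta$, $\mathrm{ht}(\gamma)$ is the sum of the coefficients of $\gamma$ in the basis $\Pi$. Extra-special case: $\Delta(j)=\{\gamma\in\Delta:(\gamma,\theta^\vee)=j\}$; $\Pi(0)=\Pi\cap\Delta(0)$; $\Delta(1)$ is partially ordered by $\mu\preccurlyeq\gamma$ iff $\gamma-\mu$ is a nonnegative integer combination of $\Pi(0)$. $\mathcal M_{\Delta(1)}(t)=\sum_I t^{\#I}$, summed over all upper ideals $I$ of $\Delta(1)$ (including $\varnothing$ and $\Delta(1)$). *)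

(* Defs.v *)
From HB Require Import structures.
From mathcomp Require Import all_boot all_order all_algebra.
From mathcomp Require Import finmap.
From mathcomp Require Import ring.
From mathcomp Require Import boolp reals.

Set Implicit Arguments.
Unset Strict Implicit.
Unset Printing Implicit Defensive.

Import Order.TTheory GRing.Theory Num.Theory.
Local Open Scope fset_scope.
Local Open Scope ring_scope.

Section RootSystems.

(* The Euclidean space is V with inner product f; {dot V for idfun} is the    *)
(* library type of symmetric positive definite bilinear forms.                *)
Variables (R : realType) (V : vectType R) (f : {dot V for idfun}).

Definition coroot (a : V) : V := (2 / f a a) *: a.

Definition reflection (a v : V) : V := v - f v (coroot a) *: a.

(* Since [reflection] is the orthogonal reflection for f, the inner product   *)
(* is invariant under the Weyl group (see [reflection_isometry]).             *)
Record root_system (D : {fset V}) : Prop := RootSystem {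
  root_span : <<D>>%VS = fullv;
  root_neq0 : 0 \notin D;
  root_refl : forall a b, a \in D -> b \in D -> reflection a b \in D;
  root_integral :
    forall a b, a \in D -> b \in D -> f b (coroot a) \is a Num.int;
  root_reduced :
    forall a (c : R), a \in D -> c *: a \in D -> c = 1 \/ c = -1 }.

Definition irreducible_roots (D : {fset V}) : Prop :=
  D != fset0 /\
  forall A B : {fset V}, A `|` B = D ->
    (forall a b, a \in A -> b \in B -> f a b = 0) -> A = fset0 \/ B = fset0.

Definition nat_comb (S : seq V) (v : V) : Prop :=
  exists c : V -> nat, v = \sum_(a <- S) a *+ c a.

Record simple_roots (D : {fset V}) (n : nat) (P : n.-tuple V) : Prop :=
  SimpleRoots {
    simple_basis : basis_of fullv P;
    simple_root : {subset P <= D};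
    simple_comb : forall a, a \in D -> nat_comb P a \/ nat_comb P (- a) }.

Definition highest_root (D : {fset V}) (n : nat) (P : n.-tuple V) (theta : V)
    : Prop :=
  theta \in D /\ forall a, a \in D -> nat_comb P (theta - a).

(* On roots the sum of coordinates is an integer, so the floor merely changes *)
(* its type from R to int (see [htE]).                                        *)
Definition ht (n : nat) (P : n.-tuple V) (v : V) : int :=
  Num.floor (\sum_(i < n) coord P i v).

Definition grade (D : {fset V}) (theta : V) (j : int) : {fset V} :=
  [fset a in D | f a (coroot theta) == j%:~R].

Definition simple_grade (D : {fset V}) (n : nat) (P : n.-tuple V) (theta : V)
    (j : int) : seq V :=
  [seq a <- P | a \in grade D theta j].

Definition grade_le (D : {fset V}) (n : nat) (P : n.-tuple V) (theta : V)
    (u v : V) : Prop :=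
  nat_comb (simple_grade D P theta 0) (v - u).

End RootSystems.

Definition upper_ideal (T : choiceType) (le : T -> T -> Prop)
    (X I : {fset T}) : Prop :=
  I `<=` X /\ forall u v, u \in I -> v \in X -> le u v -> v \in I.

Definition ideal_poly (T : choiceType) (le : T -> T -> Prop) (X : {fset T})
    : {poly int} :=
  \sum_(I <- fpowerset X | `[< upper_ideal le X I >]) 'X^#|` I|.

Section Facts.

Variables (R : realType) (V : vectType R) (f : {dot V for idfun}).

Lemma dot_sym u v : f u v = f v u.
Proof. by rewrite hermC expr0 mul1r. Qed.

Lemma reflection_isometry (a u v : V) :
  f a a != 0 -> f (reflection f a u) (reflection f a v) = f u v.
Proof.
move=> a0; rewrite /reflection /coroot !linearZr_LR /=.
rewrite !linearBl !linearBr !linearZl_LR !linearZr_LR /= (dot_sym a v).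
by field.
Qed.

Lemma htE (D : {fset V}) n (P : n.-tuple V) a :
  simple_roots D P -> a \in D -> (ht P a)%:~R = \sum_(i < n) coord P i a.
Proof.
move=> [/basis_free fP _ sc] aD; apply/eqP; rewrite -intrEfloor.
have H v : nat_comb P v -> \sum_(i < n) coord P i v \is a Num.int.
  move=> [c ->]; apply: rpred_sum => i _; rewrite linear_sum big_tuple /=.
  apply: rpred_sum => j _; rewrite raddfMn /= (tnth_nth 0) coord_free //.
  by rewrite rpredMn // natr_int.
have [/H//|/H] := sc _ aD.
by under eq_bigr do rewrite linearN; rewrite sumrN rpredN.
Qed.

End Facts.

(* Main.v *)
(* Theta grades the roots by -2, ..., 2, and grade 1 carries the involution   *)
(* dual = (theta - _).  An upper ideal I of grade 1 is disjoint from dual I,  *)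
(* or covers grade 1 together with dual I, or both.  The ideals of these two  *)
(* kinds correspond to the positive systems that contain the positive roots   *)
(* of grade 0 and, respectively, -theta or theta.  Hence, for their           *)
(* generating polynomials A and B, A + t B is a quotient of two instances of  *)
(* Macdonald's formula for the Poincare polynomial of a Weyl group, namely    *)
(* the product of (1 - t^(ht g + 1)) / (1 - t^(ht g)) over grade 1 and theta. *)
(*   The sought polynomial is A + B - m t^d, where d is half the size of      *)
(* grade 1 and m counts the ideals of both kinds.  With h = ht theta + 1, the *)
(* symmetry ht (dual g) = h - 1 - ht g makes A + t B vanish at the h-th roots *)
(* of unity other than 1, which forces                                        *)
(* B + t^(h-1) A = m t^d (1 + ... + t^(h-1)), and the theorem follows.        *)
(*   Macdonald's formula is proved without Weyl groups: positive systems are  *)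
(* handled as closed half-systems (one root from each pair +-a), and the      *)
(* Weyl denominator is expanded over all half-systems, where the terms that   *)
(* are not reflections of the positive one cancel by antisymmetry.  It is     *)
(* evaluated at real numbers t = exp k, which determine the polynomials.      *)
Require Import Defs.
From HB Require Import structures.
From mathcomp Require Import all_boot all_order all_algebra all_field.
From mathcomp Require Import finmap.
From mathcomp Require Import ring lra zify.
From mathcomp Require Import boolp reals sequences exp.

Set Implicit Arguments.
Unset Strict Implicit.
Unset Printing Implicit Defensive.

Import Order.TTheory GRing.Theory Num.Theory.
Local Open Scope fset_scope.
Local Open Scope ring_scope.

(** A simple reflection flips the sign [eps] of a half-system, and an antisymmetric function on
    half-systems has a vanishing exponential sum once it vanishes at the positive system
    ([antisym_sum0]), since no other half-system has a strictly dominant root sum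
    ([strictly_dominant_half]). Hence the signed sum of the numerators in Macdonald's formula is a
    multiple of the Weyl denominator, which proves [closed_half_gen_fun]. Applied to all roots and
    to the roots orthogonal to theta, and divided, it gives [coset_gen_fun], a product formula for
    the positive systems with standard grade 0 part. Such a positive system is an upper ideal of
    grade 1 together with a sign for theta; closure forces the ideal to be disjoint from its dual or
    to cover with it, according to that sign ([half_of_ideal_closed], [ideal_of_closed_half],
    [sum_closed_halves]). Every upper ideal is of one of these kinds ([upper_dichotomy]), so what
    remains is to pass from A + t B to A + B - m t^d. This is the polynomial statement
    [ideal_poly_core]; its inequality d < ht theta is [half_card_lt]. *)

Section DotProduct.
Variables (R : realType) (V : vectType R) (f : {dot V for idfun}).
Implicit Types (u v w : V) (k : R).

(** * The inner product, coroots and reflections *)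

Lemma dotDl u v w : f (u + v) w = f u w + f v w.
Proof. exact: linearDl. Qed.

Lemma dotDr u v w : f w (u + v) = f w u + f w v.
Proof. exact: linearDr. Qed.

Lemma dotNl u w : f (- u) w = - f u w.
Proof. exact: linearNl. Qed.

Lemma dotNr u w : f w (- u) = - f w u.
Proof. exact: linearNr. Qed.

Lemma dotZl k u w : f (k *: u) w = k * f u w.
Proof. exact: linearZl_LR. Qed.

Lemma dotZr k u w : f w (k *: u) = k * f w u.
Proof. exact: linearZr_LR. Qed.

Lemma dot0l w : f 0 w = 0. Proof. exact: linear0l. Qed.

Lemma dot0r w : f w 0 = 0. Proof. exact: linear0r. Qed.

Lemma dot_sumr (I : finType) (p : pred I) (F : I -> V) w :
  f w (\sum_(i | p i) F i) = \sum_(i | p i) f w (F i).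
Proof.
elim/big_rec2: _ => [|i x y _ <-]; first exact: dot0r.
by rewrite dotDr.
Qed.

Lemma dot_suml (I : finType) (p : pred I) (F : I -> V) w :
  f (\sum_(i | p i) F i) w = \sum_(i | p i) f (F i) w.
Proof. by rewrite dot_sym dot_sumr; apply: eq_bigr => i _; rewrite dot_sym. Qed.

Lemma dot_gt0 u : u != 0 -> 0 < f u u.
Proof. exact: neq0_dnorm_gt0. Qed.

Lemma dot_ge0 u : 0 <= f u u.
Proof. by have [->|/dot_gt0/ltW//] := eqVneq u 0; rewrite dot0l. Qed.

Lemma dot_eq0 u : (f u u == 0) = (u == 0).
Proof.
have [->|/[dup] nz /dot_gt0] := eqVneq u 0; first by rewrite dot0l eqxx.
by case: eqP => // ->; rewrite ltxx.
Qed.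

Lemma dot_coroot u v : f u (coroot f v) = 2 * f u v / f v v.
Proof. by rewrite dotZr mulrAC. Qed.

Lemma coroot_gt0 u v : v != 0 -> (0 < f u (coroot f v)) = (0 < f u v).
Proof.
move=> v0; rewrite dot_coroot mulrAC pmulr_rgt0 //.
by rewrite divr_gt0 ?ltr0n ?dot_gt0.
Qed.

Lemma coroot_eq0 u v : v != 0 -> (f u (coroot f v) == 0) = (f u v == 0).
Proof.
by move=> v0; rewrite dot_coroot !mulf_eq0 invr_eq0 dot_eq0 (negPf v0) pnatr_eq0 orbF.
Qed.

Lemma reflectionD a u v : reflection f a (u + v) = reflection f a u + reflection f a v.
Proof. by rewrite /reflection dotDl scalerDl opprD addrACA. Qed.

Lemma reflectionN a u : reflection f a (- u) = - reflection f a u.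
Proof. by rewrite /reflection dotNl scaleNr opprD. Qed.

Lemma reflection0 a : reflection f a 0 = 0.
Proof. by rewrite /reflection dot0l scale0r subr0. Qed.

Lemma reflection_sum (I : finType) (p : pred I) (F : I -> V) a :
  reflection f a (\sum_(i | p i) F i) = \sum_(i | p i) reflection f a (F i).
Proof.
elim/big_rec2: _ => [|i x y _ <-]; first exact: reflection0.
by rewrite reflectionD.
Qed.

Lemma coroot_self a : a != 0 -> f a (coroot f a) = 2.
Proof. by move=> a0; rewrite dot_coroot mulfK // dot_eq0. Qed.

Lemma reflection_self a : a != 0 -> reflection f a a = - a.
Proof.
move=> a0; rewrite /reflection coroot_self // scaler_nat mulr2n opprD addrA.
by rewrite subrr add0r.
Qed.

Lemma reflectionK a : a != 0 -> involutive (reflection f a).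
Proof.
move=> a0 v; rewrite /reflection dotDl dotNl dotZl coroot_self //.
set k := f v _; rewrite -addrA -opprD -scalerDl.
have -> : k + (k - k * 2) = 0 by ring.
by rewrite scale0r subr0.
Qed.

Lemma dot_reflection a u v : a != 0 ->
  f (reflection f a u) (reflection f a v) = f u v.
Proof. by move=> a0; rewrite reflection_isometry // dot_eq0. Qed.

Lemma reflection_fix a v : a != 0 -> f v a = 0 -> reflection f a v = v.
Proof.
by move=> a0 va; rewrite /reflection dot_coroot va mulr0 mul0r scale0r subr0.
Qed.

End DotProduct.

(** * Roots as a finite type *)

Section Roots.
Variables (R : realType) (V : vectType R) (f : {dot V for idfun}).
Variables (D : {fset V}) (rootD : root_system f D).
Local Notation T := (fset_sub_type D).
Implicit Types (a b c : T).

Definition rt a : V := val a.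

Lemma rt_inj : injective rt. Proof. exact: val_inj. Qed.

Lemma root_nz a : rt a != 0.
Proof. by apply: contraNneq (root_neq0 rootD) => <-; exact: valP. Qed.

(* Opaque, so that simplification does not expand reflected roots. *)
Fact srefl_subproof :
  {s : T -> T -> T | forall a b, rt (s a b) = reflection f (rt a) (rt b)}.
Proof.
by exists (fun a b => [` root_refl rootD (valP a) (valP b)]).
Qed.

Definition srefl := sval srefl_subproof.
Definition sneg a : T := srefl a a.

Lemma sreflE a b : rt (srefl a b) = reflection f (rt a) (rt b).
Proof. exact: (svalP srefl_subproof). Qed.

Lemma snegE a : rt (sneg a) = - rt a.
Proof. by rewrite sreflE reflection_self ?root_nz. Qed.

Lemma snegK : involutive sneg.
Proof. by move=> a; apply: rt_inj; rewrite !snegE opprK. Qed.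

Lemma sreflK a : involutive (srefl a).
Proof. by move=> b; apply: rt_inj; rewrite !sreflE reflectionK ?root_nz. Qed.

Lemma srefl_neg a b : srefl a (sneg b) = sneg (srefl a b).
Proof. by apply: rt_inj; rewrite !(snegE, sreflE) reflectionN. Qed.

Lemma sneg_neq a : sneg a != a.
Proof.
apply/eqP => /(congr1 rt)/eqP; rewrite snegE -subr_eq0 -opprD oppr_eq0.
by rewrite -mulr2n -scaler_nat scaler_eq0 pnatr_eq0 (negPf (root_nz a)).
Qed.

Lemma root_int a b : f (rt b) (coroot f (rt a)) \is a Num.int.
Proof. by apply: (root_integral rootD); exact: valP. Qed.

Lemma root_prop a b k : rt b = k *: rt a -> b = a \/ b = sneg a.
Proof.
move=> E; have bD := valP b.
have /(root_reduced rootD (valP a)) : k *: rt a \in D by rewrite -E.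
by case=> k1; [left|right]; apply: rt_inj;
   rewrite ?snegE E k1 ?scale1r ?scaleN1r.
Qed.

(** One of the two Cartan integers is 1; otherwise both are at least 2 and |a - b|^2 <= 0. The
    difference is also exhibited through reflections, so that it stays in any set of roots closed
    under them. *)
Lemma root_string a b : 0 < f (rt a) (rt b) -> a != b ->
  exists c, rt c = rt a - rt b /\
    (c = srefl b a \/ c = sneg (srefl a b)).
Proof.
move=> ab0 neq_ab.
have a0 := root_nz a; have b0 := root_nz b.
have [/eqP h|h1] := boolP (f (rt a) (coroot f (rt b)) == 1).
  by exists (srefl b a); split; [rewrite sreflE /reflection h scale1r|left].
have [/eqP h|h2] := boolP (f (rt b) (coroot f (rt a)) == 1).
  exists (sneg (srefl a b)); split; last by right.
  by rewrite snegE sreflE /reflection h scale1r opprB.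
exfalso.
have two (x y : T) : 0 < f (rt x) (rt y) -> f (rt x) (coroot f (rt y)) != 1 ->
    f (rt y) (rt y) <= f (rt x) (rt y).
  move=> xy; have := root_int y x => /intrP[m E].
  have := coroot_gt0 f (rt x) (root_nz y); rewrite xy E.
  rewrite ltr0z => m0; rewrite (eqr_int _ m 1) => m1.
  have : (2 <= m)%R by case: m m0 m1 {E} => // -[|[|m]].
  rewrite -(ler_int R) -E dot_coroot ler_pdivlMr ?dot_gt0 ?root_nz //.
  by rewrite ler_pM2l.
have L1 := two _ _ ab0 h1.
have L2 : f (rt a) (rt a) <= f (rt a) (rt b).
  by rewrite [leRHS]dot_sym; apply: two => //; rewrite dot_sym.
have : f (rt a - rt b) (rt a - rt b) <= 0.
  rewrite dotDl !dotDr !dotNl !dotNr (dot_sym f (rt b)) opprK.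
  lra.
rewrite le_eqVlt ltNge dot_ge0 orbF dot_eq0 subr_eq0 => /eqP/rt_inj E.
by rewrite E eqxx in neq_ab.
Qed.

End Roots.

Arguments rt : simpl never.
Arguments sneg : simpl never.

(** * Half-systems and Macdonald's product formula *)

Section SimpleSystem.
Variables (R : realType) (V : vectType R) (f : {dot V for idfun}).
Variables (D : {fset V}) (rootD : root_system f D).
Variable ht : {scalar V}.
Local Notation T := (fset_sub_type D).
Local Notation srefl := (srefl rootD).
Local Notation sneg := (sneg rootD).
Implicit Types (a b c i : T) (X S Y Z : {set T}) (v : V).

Definition ncomb S v : Prop :=
  exists c : T -> nat, v = \sum_(i in S) (c i)%:R *: rt i.

(** Relative to a reflection-closed set [X], so as to serve both for all roots and for those
    orthogonal to theta, with the same height functional. *)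
Record simple_system X S : Prop := SimpleSystem {
  sys_refl : forall a b, a \in X -> b \in X -> srefl a b \in X;
  sys_sub : {subset S <= X};
  sys_ht : forall i, i \in S -> ht (rt i) = 1;
  sys_free : forall x : T -> R, \sum_(i in S) x i *: rt i = 0 ->
    forall i, i \in S -> x i = 0;
  sys_comb : forall a, a \in X -> ncomb S (rt a) \/ ncomb S (- rt a) }.

Definition positive X : {set T} := [set a in X | 0 < ht (rt a)].

Definition half X Z :=
  (Z \subset X) && [forall a in X, (sneg a \in Z) == (a \notin Z)].

(* For a half-system, being closed under addition amounts to having no three *)
(* elements of sum zero.                                                     *)
Definition closed_half X Y :=
  half X Y && [forall a in Y, forall b in Y, forall c in Y,
                 rt a + rt b + rt c != 0].

(** For the positive system this is 2 rho; for half-systems, these are the exponents of the expanded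
    Weyl denominator, doubled. *)
Definition vsum Z : V := \sum_(a in Z) rt a.

Lemma vsum_refl i Z : vsum (srefl i @^-1: Z) = reflection f (rt i) (vsum Z).
Proof.
rewrite /vsum reflection_sum (reindex_inj (inv_inj (sreflK rootD i))) /=.
by apply: eq_big => [a|a _]; rewrite ?inE ?sreflK ?sreflE.
Qed.

Lemma preimset_sreflK i : involutive (fun Z => srefl i @^-1: Z).
Proof. by move=> Z; apply/setP => a; rewrite !inE sreflK. Qed.

(** * Heights, positive roots and simple reflections *)

Variables (X S : {set T}) (sysX : simple_system X S).
Local Notation pos := (positive X).

Lemma ht_refl i v : i \in S ->
  ht (reflection f (rt i) v) = ht v - f v (coroot f (rt i)).
Proof. by move=> iS; rewrite linearB linearZ /= (sys_ht sysX) // mulr1. Qed.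

Lemma ht_comb (c : T -> R) :
  ht (\sum_(i in S) c i *: rt i) = \sum_(i in S) c i.
Proof.
rewrite linear_sum; apply: eq_bigr => i iS.
by rewrite linearZ /= (sys_ht sysX) // mulr1.
Qed.

Lemma ncomb_ht v : ncomb S v -> exists m : nat,
  ht v = m%:R /\ (m = 0%N -> v = 0).
Proof.
move=> [c ->]; exists (\sum_(i in S) c i)%N; rewrite ht_comb natr_sum; split=> //.
move=> /eqP; rewrite sum_nat_eq0 => /forall_inP h.
by apply: big1 => i /h/eqP ->; rewrite scale0r.
Qed.

Lemma in_X_refl i a : i \in X -> (srefl i a \in X) = (a \in X).
Proof.
move=> iX; apply/idP/idP; last exact: (sys_refl sysX).
by move/(sys_refl sysX iX); rewrite sreflK.
Qed.

Lemma in_X_neg a : (sneg a \in X) = (a \in X).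
Proof.
apply/idP/idP => aX; last exact: (sys_refl sysX).
by rewrite -(snegK rootD a) (sys_refl sysX).
Qed.

Lemma ht_root a : a \in X -> exists2 m : nat,
  (0 < m)%N & ht (rt a) = m%:R \/ ht (rt a) = - m%:R.
Proof.
move=> aX; have nz m : ht (rt a) = m%:R \/ ht (rt a) = - m%:R ->
    (m = 0%N -> rt a = 0) -> exists2 m : nat,
      (0 < m)%N & ht (rt a) = m%:R \/ ht (rt a) = - m%:R.
  case: m => [_ /(_ erefl)/eqP|m h _]; first by rewrite (negPf (root_nz rootD a)).
  by exists m.+1.
have [/ncomb_ht[m [hm m0]]|/ncomb_ht[m [hm m0]]] := sys_comb sysX aX.
  by apply: nz m0; left.
apply: (nz m); first by right; rewrite -hm linearN opprK.
by move=> /m0/eqP; rewrite oppr_eq0 => /eqP.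
Qed.

Lemma pos_sub a : a \in pos -> a \in X.
Proof. by rewrite inE => /andP[]. Qed.

Lemma pos_gt0 a : a \in pos -> 0 < ht (rt a).
Proof. by rewrite inE => /andP[]. Qed.

Lemma pos_neg a : a \in X -> (sneg a \in pos) = (a \notin pos).
Proof.
move=> aX; rewrite !inE in_X_neg aX /= snegE linearN oppr_gt0 -leNgt le_eqVlt.
have [m m0 h] := ht_root aX; suff /negPf-> : ht (rt a) != 0 by [].
by case: h => ->; rewrite ?oppr_eq0 pnatr_eq0 -lt0n.
Qed.

Lemma pos_half : half X pos.
Proof.
apply/andP; split; first by apply/subsetP => a /pos_sub.
by apply/forall_inP => a aX; rewrite pos_neg.
Qed.

Lemma simple_pos i : i \in S -> i \in pos.
Proof.
by move=> iS; rewrite inE (sys_sub sysX) //= (sys_ht sysX) // ltr01.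
Qed.

Lemma pos_comb a : a \in pos -> ncomb S (rt a).
Proof.
move=> ap; have [//|/ncomb_ht[m [hm _]]] := sys_comb sysX (pos_sub ap).
by have := pos_gt0 ap; rewrite -oppr_lt0 -linearN hm ltNge ler0n.
Qed.

Lemma pos_ht a : a \in pos -> exists2 m : nat, (0 < m)%N & ht (rt a) = m%:R.
Proof.
move=> ap; have [m m0 [|E]] := ht_root (pos_sub ap); first by exists m.
by have := pos_gt0 ap; rewrite E oppr_gt0 ltNge ler0n.
Qed.

Lemma half_sub Z a : half X Z -> a \in Z -> a \in X.
Proof. by case/andP => /subsetP h _; exact: h. Qed.

Lemma half_neg Z a : half X Z -> a \in X -> (sneg a \in Z) = (a \notin Z).
Proof. by case/andP => _ /forall_inP h aX; rewrite (eqP (h _ aX)). Qed.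

Lemma half_refl i Z : i \in X -> half X Z -> half X (srefl i @^-1: Z).
Proof.
move=> iX hZ; apply/andP; split.
  by apply/subsetP => a; rewrite inE => /(half_sub hZ); rewrite in_X_refl.
apply/forall_inP => a aX; rewrite !inE srefl_neg.
by rewrite (half_neg hZ) // in_X_refl.
Qed.

Lemma half_refl_eq i Z : i \in X -> half X (srefl i @^-1: Z) = half X Z.
Proof.
move=> iX; apply/idP/idP => [/(half_refl iX)|]; last exact: half_refl.
by rewrite preimset_sreflK.
Qed.

(** The reflection changes only the coefficient of [i]. Were the image negative, all other
    coefficients would vanish and [a] would be proportional to [i]. *)
Lemma refl_pos i a : i \in S -> a \in pos -> a != i -> srefl i a \in pos.
Proof.
move=> iS ap ai; have iX := sys_sub sysX iS; have aX := pos_sub ap.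
apply: contraT; rewrite -pos_neg ?in_X_refl //.
move=> /pos_comb[d dE]; have [c cE] := pos_comb ap.
set k := f (rt a) (coroot f (rt i)).
(* Coefficients of [rt a - reflection f (rt i) (rt a) = k *: rt i]; [d] holds those of the negated
   reflection. *)
have E j : j \in S -> (c j)%:R + (d j)%:R - (if j == i then k else 0) = 0 :> R.
  move: j; apply: (sys_free sysX).
  under eq_bigr => j _ do rewrite scalerBl scalerDl.
  rewrite sumrB big_split /= -cE -dE snegE sreflE /reflection -/k.
  rewrite (bigD1 i) //= eqxx big1 => [|j /andP[_ /negPf->]]; last by rewrite scale0r.
  by rewrite addr0 subKr subrr.
have c0 j : j \in S -> j != i -> c j = 0%N.
  move=> jS ji; have := E _ jS; rewrite (negPf ji) subr0 -natrD => /eqP.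
  by rewrite pnatr_eq0 addn_eq0 => /andP[/eqP].
have aE : rt a = (c i)%:R *: rt i.
  rewrite cE (bigD1 i) //= big1 ?addr0 // => j /andP[jS ji].
  by rewrite c0 // scale0r.
have [E1|E1] := root_prop rootD aE; first by rewrite E1 eqxx in ai.
by move: ap; rewrite E1 pos_neg // simple_pos.
Qed.

Lemma refl_pos_eq i : i \in S ->
  srefl i @^-1: pos = sneg i |: pos :\ i.
Proof.
move=> iS; have iX := sys_sub sysX iS; have ip := simple_pos iS.
apply/setP => a; rewrite in_setU1 in_setD1 [LHS]inE.
have [->|ani] /= := eqVneq a (sneg i).
  by rewrite srefl_neg snegK.
have [->|ai] /= := eqVneq a i.
  by rewrite pos_neg // ip.
apply/idP/idP => [h|ap]; last exact: refl_pos.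
rewrite -(sreflK rootD i a) refl_pos //.
by apply: contraNneq ani => E; rewrite -(sreflK rootD i a) E.
Qed.

(** By [refl_pos_eq] the reflection only trades [i] for its opposite, so it lowers 2 rho by twice
    [rt i]. *)
Lemma vsum_pos i : i \in S -> f (vsum pos) (coroot f (rt i)) = 2.
Proof.
move=> iS; have iX := sys_sub sysX iS; have ip := simple_pos iS.
have := vsum_refl i pos; rewrite refl_pos_eq // {1}/vsum.
rewrite big_setU1 /=; last by rewrite !inE in_X_neg iX /= snegE linearN oppr_gt0
  (sys_ht sysX) // ltr10 andbF.
rewrite /reflection snegE; set k := f _ _.
have -> : \sum_(a in pos :\ i) rt a = vsum pos - rt i.
  by rewrite /vsum [in RHS](big_setD1 i ip) /= addrAC subrr add0r.
rewrite addrC -addrA => /addrI/eqP; rewrite -opprD eqr_opp -mulr2n -scaler_nat.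
rewrite -subr_eq0 -scalerBl scaler_eq0 (negPf (root_nz rootD i)) orbF subr_eq0.
by move/eqP.
Qed.

(** * Signs of half-systems and antisymmetric sums *)

Definition eps Z : R := (-1) ^+ #|Z :\: pos|.

(** Moving the reflection onto [pos] trades [i] for its opposite there; [Z] contains exactly one of
    the two, so the count changes by one. On the image of [pos] under w, [eps] is thus the sign of
    w. *)
Lemma eps_refl i Z : i \in S -> half X Z ->
  eps (srefl i @^-1: Z) = - eps Z.
Proof.
move=> iS hZ; have iX := sys_sub sysX iS; have ip := simple_pos iS.
have -> : eps (srefl i @^-1: Z) = (-1) ^+ #|Z :\: srefl i @^-1: pos|.
  rewrite /eps -(card_preimset (srefl i @^-1: Z :\: pos) (inv_inj (sreflK rootD i))).
  by rewrite preimsetD preimset_sreflK.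
rewrite refl_pos_eq // /eps.
have nip : sneg i \notin pos by rewrite pos_neg ?ip.
have [iZ|iZ] := boolP (i \in Z).
  have -> : Z :\: (sneg i |: pos :\ i) = i |: (Z :\: pos).
    apply/setP => a; rewrite in_setU1 !in_setD in_setU1 in_setD1.
    have [->|ani] /= := eqVneq a (sneg i).
      by rewrite (half_neg hZ) // iZ andbF (negPf (sneg_neq rootD i)).
    by have [->|] //= := eqVneq a i.
  by rewrite cardsU1 in_setD ip /= add1n exprS mulN1r.
have -> : Z :\: pos = sneg i |: Z :\: (sneg i |: pos :\ i).
  apply/setP => a; rewrite in_setU1 !in_setD in_setU1 in_setD1.
  have [->|ani] /= := eqVneq a (sneg i).
    by rewrite (half_neg hZ) // iZ nip.
  by have [->|] //= := eqVneq a i; rewrite (negPf iZ) !andbF.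
by rewrite cardsU1 in_setD in_setU1 eqxx /= add1n exprS mulN1r opprK.
Qed.
Lemma vsum_half Z : half X Z ->
  vsum Z = vsum pos - 2 *: \sum_(a in pos :\: Z) rt a.
Proof.
move=> hZ.
have -> : vsum Z = \sum_(a in pos :&: Z) rt a - \sum_(a in pos :\: Z) rt a.
  rewrite /vsum (big_setID pos) /= setIC; congr (_ + _).
  rewrite (reindex_inj (inv_inj (snegK rootD))) -sumrN /=.
  apply: eq_big => [a|a _]; last by rewrite snegE.
  rewrite !in_setD; have [aX|aX] := boolP (a \in X).
    by rewrite pos_neg // negbK (half_neg hZ) // andbC.
  apply/andP/andP => -[_ h]; last by rewrite (pos_sub h) in aX.
  by have := half_sub hZ h; rewrite in_X_neg (negPf aX).
rewrite /vsum [in RHS](big_setID Z) /= scaler_nat mulr2n opprD addrA.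
by rewrite [in RHS]addrK.
Qed.

Lemma half_pos_eq Z : half X Z -> pos \subset Z -> Z = pos.
Proof.
move=> hZ /subsetP sub; apply/setP => a; apply/idP/idP => [aZ|/sub//].
have aX := half_sub hZ aZ; apply: contraLR aZ => nap.
rewrite -(half_neg hZ) //; apply: sub; by rewrite pos_neg.
Qed.

Lemma ncomb_sum (p : pred T) (F : T -> V) :
  (forall a, p a -> ncomb S (F a)) -> ncomb S (\sum_(a | p a) F a).
Proof.
move=> h; elim/big_rec: _ => [|a v pa [c ->]].
  by exists (fun=> 0%N); rewrite big1 // => i _; rewrite scale0r.
have [d ->] := h _ pa; exists (fun i => d i + c i)%N.
by rewrite -big_split; apply: eq_bigr => i _; rewrite natrD scalerDl.
Qed.

(* With rho half the sum of the positive roots, [vsum Z / 2 = rho - s] where  *)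
(* [s] is a sum of positive roots; strict dominance and integrality force     *)
(* [s] to be antidominant, hence of nonpositive square length.                *)
Lemma strictly_dominant_half Z : half X Z ->
  (forall i, i \in S -> 0 < f (vsum Z) (rt i)) -> Z = pos.
Proof.
move=> hZ dom; apply: half_pos_eq => //.
set s := \sum_(a in pos :\: Z) rt a.
have [c sE] : ncomb S s by apply: ncomb_sum => a /setDP[/pos_comb].
have anti i : i \in S -> f s (rt i) <= 0.
  move=> iS; rewrite -(pmulr_rle0 _ (ltr0n R 2)).
  have := dom _ iS; rewrite -(coroot_gt0 f _ (root_nz rootD i)) vsum_half // -/s.
  rewrite dotDl dotNl dotZl vsum_pos //.
  have : f s (coroot f (rt i)) \is a Num.int.
    by rewrite dot_suml; apply: rpred_sum => a _; exact: root_int.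
  move=> /intrP[m mE]; rewrite leNgt pmulr_rgt0 // -(coroot_gt0 f _ (root_nz rootD i)) mE.
  rewrite ltr0z -leNgt => h; have : (m%:~R : R) < 1 by lra.
  by rewrite -[1]/(1%:~R) ltr_int; case: m {mE h} => // -[].
have : f s s <= 0.
  rewrite {2}sE dot_sumr; apply: sumr_le0 => i iS.
  by rewrite dotZr mulr_ge0_le0 // anti.
rewrite le_eqVlt ltNge dot_ge0 orbF dot_eq0 => /eqP s0.
apply/subsetP => a ap; apply: contraT => aZ.
have : ht s = 0 by rewrite s0 linear0.
rewrite linear_sum /= (bigD1 a) /=; last by rewrite in_setD aZ.
move=> /eqP; rewrite paddr_eq0 ?(ltW (pos_gt0 ap)) //.
  by rewrite gt_eqF // pos_gt0.
by apply: sumr_ge0 => b /andP[/setDP[bp _] _]; rewrite ltW // pos_gt0.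
Qed.

Section Antisymmetric.
Variables (h : {set T} -> R) (E : V -> R).
Hypothesis h_refl : forall i Z, i \in S -> half X Z ->
  h (srefl i @^-1: Z) = - h Z.
Hypothesis h_pos : h pos = 0.

(** The coefficient of the exponential of [v] after collecting equal exponents. *)
Let C v := \sum_(Z | half X Z && (vsum Z == v)) h Z.

Let C_refl i v : i \in S -> C (reflection f (rt i) v) = - C v.
Proof.
move=> iS; have iX := sys_sub sysX iS.
rewrite /C (reindex_inj (inv_inj (preimset_sreflK i))) /= -sumrN.
apply: eq_big => [Z|Z /andP[hZ _]]; last by rewrite h_refl // -(half_refl_eq _ iX).
rewrite half_refl_eq // vsum_refl; congr (_ && _).
by rewrite (inj_eq (inv_inj (reflectionK f (root_nz rootD i)))).
Qed.

(** Among the half-systems with nonzero coefficient, take one whose root sum is highest. The sum is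
    dominant, as a reflection would otherwise raise it, and strictly so, as on a wall the
    coefficient equals its opposite. Then only [pos] has this root sum, and [h] vanishes there. *)
Let C0 Z : half X Z -> C (vsum Z) = 0.
Proof.
move=> hZ; apply/eqP; apply: contraT => CZ.
pose p (Y : {set T}) := half X Y && (C (vsum Y) != 0).
have pZ : p Z by rewrite /p hZ.
case: (Order.TotalTheory.arg_maxP (fun Y : {set T} => ht (vsum Y)) pZ).
move=> Y /andP[hY CY] Ymax.
have nneg i : i \in S -> 0 <= f (vsum Y) (rt i).
  move=> iS; have iX := sys_sub sysX iS; rewrite leNgt; apply/negP => neg.
  have /Ymax : p (srefl i @^-1: Y).
    by rewrite /p half_refl // vsum_refl C_refl // oppr_eq0.
  rewrite vsum_refl ht_refl // /= -subr_ge0 opprB addrCA subrr addr0.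
  rewrite dot_coroot mulrAC pmulr_rge0 ?leNgt ?neg //.
  by rewrite divr_gt0 // dot_gt0 // (root_nz rootD).
have pos' i : i \in S -> 0 < f (vsum Y) (rt i).
  move=> iS; rewrite lt_neqAle nneg // andbT eq_sym; apply: contraNneq CY => Y0.
  have := C_refl (vsum Y) iS; rewrite reflection_fix ?(root_nz rootD) // => /eqP.
  by rewrite -addr_eq0 -mulr2n mulrn_eq0.
move: CY; rewrite /C (big_pred1 pos) ?h_pos ?eqxx // => Y'.
apply/andP/eqP => [[hY' /eqP E']|->].
  by apply: strictly_dominant_half => // i iS; rewrite E' pos'.
by rewrite pos_half (strictly_dominant_half hY).
Qed.

Lemma antisym_sum0 : \sum_(Z | half X Z) h Z * E (vsum Z) = 0.
Proof.
pose J := seq_sub (codom vsum); pose q Z : J := SeqSub (codom_f vsum Z).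
rewrite (partition_big q xpredT) //=; apply: big1 => -[v vJ] _.
rewrite (eq_bigr (fun Z => h Z * E v)) => [|Z /andP[_ /eqP[->//]]].
rewrite -big_distrl (eq_bigl (fun Z => half X Z && (vsum Z == v))) //=.
have [/existsP[Y /andP[hY /eqP Yv]]|none] :=
  boolP [exists Y, half X Y && (vsum Y == v)].
  by rewrite -Yv [X in X * _](C0 hY) mul0r.
rewrite big_pred0 ?mul0r // => Z; apply/negbTE; apply: contraNN none.
by move=> hZ; apply/existsP; exists Z.
Qed.

End Antisymmetric.

(** Choosing [F] on a subset J of [Y] and [G] on the rest yields the half-system made of J and the
    opposites of the rest; each half-system arises once. *)
Lemma prod_half (F G : T -> R) Y : half X Y ->
  \prod_(a in Y) (F a + G (sneg a)) =
  \sum_(Z | half X Z) (\prod_(a in Z :&: Y) F a) * \prod_(a in Z :\: Y) G a.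
Proof.
move=> hY; pose h J := J :|: sneg @^-1: (Y :\: J).
have hK Z : half X Z -> h (Z :&: Y) = Z.
  move=> hZ; apply/setP => a; rewrite in_setU !inE.
  have [aX|aX] := boolP (a \in X).
    by rewrite (half_neg hZ) // (half_neg hY) //; case: (a \in Z); case: (a \in Y).
  have nX W b : half X W -> b \notin X -> b \in W = false.
    by move=> hW; apply: contraNF => /(half_sub hW).
  by rewrite !(nX Z) ?(nX Y) ?in_X_neg.
have dY (J : {set T}) a : J \subset Y -> a \in X ->
    (a \in h J) = (if a \in Y then a \in J else sneg a \notin J).
  move=> /subsetP sub aX; rewrite in_setU !inE (half_neg hY) //.
  have [aY|aY] /= := boolP (a \in Y); first by rewrite andbF orbF.
  by rewrite andbT (contraNF (sub a) aY).
rewrite (reindex_onto h (fun Z => Z :&: Y)) //=.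
rewrite big_mkcond /= (eq_bigr (fun a => (if a \in Y then F a else 0) +
   (if a \in Y then G (sneg a) else 1))); last first.
  by move=> a _; case: ifP; rewrite ?add0r.
rewrite bigA_distr /= (bigID (fun J : {set T} => J \subset Y)) /=.
rewrite [X in _ + X]big1 ?addr0 => [|J /subsetPn[a aJ aY]]; last first.
  by rewrite (bigD1 a) //= aJ (negPf aY) mul0r.
have hJY (J : {set T}) : J \subset Y -> h J :&: Y = J.
  move=> sub; apply/setP => a; rewrite in_setI.
  have [aY|aY] := boolP (a \in Y).
    by rewrite dY ?aY ?andbT // (half_sub hY).
  by rewrite andbF; apply/esym/negbTE; apply: contraNN aY; apply: (subsetP sub).
have hJD (J : {set T}) : J \subset Y -> h J :\: Y = sneg @^-1: (Y :\: J).
  move=> sub; apply/setP => a; rewrite in_setD in_setU !inE.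
  have [aX|aX] := boolP (a \in X).
    rewrite (half_neg hY) //; have [aY|aY] /= := boolP (a \in Y); rewrite ?andbF //.
    by rewrite (contraNF (subsetP sub a) aY).
  have nX b : b \notin X -> b \in Y = false.
    by apply: contraNF => /(half_sub hY).
  rewrite !nX ?in_X_neg // andbF orbF /=.
  by apply/negbTE; apply: contraNN aX => /(subsetP sub)/(half_sub hY).
apply: eq_big => [J|J sub].
  apply/idP/andP => [sub|[_ /eqP <-]]; last exact: subsetIr.
  split; last by rewrite hJY.
  apply/andP; split.
    apply/subsetP => a; rewrite in_setU !inE => /orP[/(subsetP sub)/(half_sub hY)//|].
    by move=> /andP[_ /(half_sub hY)]; rewrite in_X_neg.
  apply/forall_inP => a aX; rewrite !dY ?in_X_neg // snegK (half_neg hY) //.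
  by case: (a \in Y); rewrite ?negbK.
rewrite big_if /= hJY // hJD //; congr (_ * _).
  by apply: eq_bigr => a aJ; rewrite (subsetP sub).
rewrite -big_mkcondr /= [RHS](reindex_inj (inv_inj (snegK rootD))) /=.
by apply: eq_bigl => a; rewrite !inE snegK.
Qed.

Lemma card_half Y : half X Y -> #|Y| = #|pos|.
Proof.
move=> hY; rewrite -(cardsID pos Y) -[RHS](cardsID Y pos) setIC; congr addn.
rewrite -(card_preimset (pos :\: Y) (inv_inj (snegK rootD))).
apply: eq_card => a; rewrite in_setD [RHS]inE in_setD.
have [aX|aX] := boolP (a \in X).
  by rewrite pos_neg // (half_neg hY) // negbK andbC.
apply/andP/andP => -[_ h]; first by rewrite (half_sub hY h) in aX.
by have := pos_sub h; rewrite in_X_neg (negPf aX).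
Qed.

(** * Closed half-systems as positive systems *)

Lemma closed_half_half Y : closed_half X Y -> half X Y.
Proof. by case/andP. Qed.

Lemma closed_half_sum Y a b c : closed_half X Y -> a \in Y -> b \in Y ->
  c \in Y -> rt a + rt b + rt c != 0.
Proof.
by case/andP => _ /forall_inP h /h/forall_inP {}h /h/forall_inP; apply.
Qed.

Lemma closed_half_refl i Y : i \in S -> closed_half X Y ->
  closed_half X (srefl i @^-1: Y).
Proof.
move=> iS cY; have iX := sys_sub sysX iS.
apply/andP; split; first by rewrite half_refl // closed_half_half.
apply/forall_inP => a; rewrite inE => aY; apply/forall_inP => b; rewrite inE => bY.
apply/forall_inP => c; rewrite inE => cY'.
have := closed_half_sum cY aY bY cY'; rewrite !sreflE -!reflectionD.
by apply: contraNneq => ->; rewrite reflection0.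
Qed.

Lemma closed_half_refl_eq i Y : i \in S ->
  closed_half X (srefl i @^-1: Y) = closed_half X Y.
Proof.
move=> iS; apply/idP/idP => [/(closed_half_refl iS)|]; last exact: closed_half_refl.
by rewrite preimset_sreflK.
Qed.

Lemma pos_closed : closed_half X pos.
Proof.
apply/andP; split; first exact: pos_half.
apply/forall_inP => a /pos_gt0 a0; apply/forall_inP => b /pos_gt0 b0.
apply/forall_inP => c /pos_gt0 c0.
suff : ht (rt a + rt b + rt c) != 0 by apply: contraNneq => ->; rewrite linear0.
by rewrite !linearD /= gt_eqF // !addr_gt0.
Qed.

(** As (a, a) > 0, some simple [i] has (a, i) > 0, so a - i is a root; its height is not negative,
    hence it is positive. *)
Lemma pos_decomp a : a \in pos -> a \notin S ->
  exists i b, [/\ i \in S, b \in pos & rt a = rt b + rt i].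
Proof.
move=> ap aS; have aX := pos_sub ap; have [c cE] := pos_comb ap.
have /exists_inP[i iS ai] : [exists i in S, 0 < f (rt a) (rt i)].
  apply: contraT => /exists_inPn none.
  have := dot_gt0 f (root_nz rootD a); rewrite {2}cE dot_sumr.
  rewrite ltNge sumr_le0 // => i /none; rewrite -leNgt dotZr => h.
  by rewrite mulr_ge0_le0.
have nai : a != i by apply: contraNneq aS => ->.
have iX := sys_sub sysX iS.
have [b [bE b']] := root_string rootD ai nai.
have bX : b \in X.
  by case: b' => ->; rewrite ?in_X_neg (sys_refl sysX).
exists i, b; split=> //; last by rewrite bE subrK.
apply: contraT; rewrite -pos_neg // => /pos_gt0.
rewrite snegE bE opprB linearB /= (sys_ht sysX) // subr_gt0.
have [m m0 ->] := pos_ht ap.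
by rewrite -[1]/(1%:R) ltr_nat ltnS leqNgt m0.
Qed.

Lemma closed_half_simple Y : closed_half X Y -> {subset S <= Y} -> Y = pos.
Proof.
move=> cY sub; have hY := closed_half_half cY; apply: half_pos_eq => //.
suff h m a : a \in pos -> ht (rt a) < m%:R -> a \in Y.
  apply/subsetP => a ap; have [m m0 E] := pos_ht ap.
  by apply: (h m.+1) => //; rewrite E ltr_nat.
elim: m a => [|m IH] a ap; first by rewrite ltNge ltW // pos_gt0.
have [/sub//|aS] := boolP (a \in S).
have [i [b [iS bp E]]] := pos_decomp ap aS.
rewrite E linearD (sys_ht sysX iS) -natr1 ltrD2r => /IH-/(_ bp) bY.
apply: contraT => aY; have := closed_half_sum cY bY (sub _ iS).
move=> /(_ (sneg a)); rewrite (half_neg hY) ?aY ?(pos_sub ap) // => /(_ isT).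
by rewrite snegE E subrr eqxx.
Qed.

(** Transitivity of the Weyl group on positive systems: reflecting in a simple root missing from [Y]
    brings [Y] closer to [pos]. *)
Lemma closed_half_const (A : Type) (q : {set T} -> A) :
  (forall i Y, i \in S -> closed_half X Y -> q (srefl i @^-1: Y) = q Y) ->
  forall Y, closed_half X Y -> q Y = q pos.
Proof.
move=> q_refl Y.
have [m] := ubnP #|Y :\: pos|; elim: m Y => // m IH Y le_m cY.
have hY := closed_half_half cY.
have [/subsetP/(closed_half_simple cY)->//|/subsetPn[i iS iY]] := boolP (S \subset Y).
have iX := sys_sub sysX iS; have ip := simple_pos iS.
rewrite -(q_refl i) //; apply: IH; last exact: closed_half_refl.
rewrite -(card_preimset _ (inv_inj (sreflK rootD i))) preimsetD preimset_sreflK.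
rewrite refl_pos_eq //; move: le_m; rewrite ltnS; apply: leq_trans; apply: proper_card.
apply/properP; split; last first.
  exists (sneg i); last by rewrite in_setD in_setU1 eqxx.
  by rewrite in_setD pos_neg // ip (half_neg hY) // iY.
apply/subsetP => a; rewrite !in_setD in_setU1 in_setD1 => /andP[+ aY].
by rewrite aY andbT; apply: contraNN => ->; rewrite andbT; apply/orP; right;
  apply: contraNneq iY => <-.
Qed.

(* Expand each numerator, a product over a closed half-system Y, into a sum   *)
(* over half-systems; all numerators but the one of [Y = pos] vanish, since   *)
(* every other Y contains the opposite of a simple root.                      *)
Lemma closed_half_gen_fun (k : R) :
  (\sum_(Y | closed_half X Y) expR (2 * k) ^+ #|Y :&: pos|) *
    \prod_(a in pos) (1 - expR (2 * k * ht (rt a))) =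
  \prod_(a in pos) (1 - expR (2 * k) * expR (2 * k * ht (rt a))).
Proof.
(* [E] is a square root of [t] to the height, as the Weyl denominator involves exponentials of
   half-roots. *)
pose t := expR (2 * k); pose E v := expR (k * ht v).
have E2 v : expR (2 * k * ht v) = E v * E v by rewrite -expRD; congr expR; ring.
have EN a : E (rt (sneg a)) = (E (rt a))^-1 by rewrite snegE /E linearN mulrN expRN.
have E0 v : E v != 0 by rewrite /E expR_eq0.
have Esum Z : \prod_(a in Z) E (rt a) = E (vsum Z).
  by rewrite /E /vsum linear_sum mulr_sumr expR_sum.
have expand u Y : half X Y -> \prod_(a in Y) (E (rt (sneg a)) - u * E (rt a)) =
    \sum_(Z | half X Z) (- u) ^+ #|Z :&: Y| * E (vsum Z).
  move=> hY; under eq_bigr do rewrite addrC -mulNr.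
  rewrite (prod_half (fun a => - u * E (rt a)) (fun a => E (rt a)) hY).
  apply: eq_bigr => Z _; rewrite big_split /= prodr_const -mulrA; congr (_ * _).
  by rewrite -Esum [RHS](big_setID Y).
have epsE Z : half X Z -> eps Z = (-1) ^+ #|pos| * (-1) ^+ #|Z :&: pos|.
  move=> hZ; rewrite -(card_half hZ) -(cardsID pos Z) exprD mulrAC -expr2.
  by rewrite sqrr_sign mul1r.
(* The coefficient of [E (vsum Z)] in the sum of all expanded numerators, weighted by [eps]. *)
pose g Z := \sum_(Y | closed_half X Y) eps Y * (- t) ^+ #|Z :&: Y|.
have g_refl i Z : i \in S -> half X Z -> g (srefl i @^-1: Z) = - g Z.
  move=> iS hZ; rewrite /g (reindex_inj (inv_inj (preimset_sreflK i))) /= -sumrN.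
  apply: eq_big => [Y|Y]; first exact: closed_half_refl_eq.
  rewrite closed_half_refl_eq // => cY; rewrite eps_refl // ?closed_half_half //.
  by rewrite -preimsetI card_preimset ?mulNr //; exact: inv_inj (sreflK rootD i).
(* Subtracting [g pos * eps Z] makes the value at [pos] zero; so the sum of the numerators is
   [g pos] times the Weyl denominator. *)
have := @antisym_sum0 (fun Z => g Z - g pos * eps Z) E.
have eps_pos : eps pos = 1 by rewrite /eps setDv cards0.
rewrite eps_pos mulr1 subrr => /(_ _ erefl) H.
have {}H : \sum_(Z | half X Z) g Z * E (vsum Z) =
    g pos * \sum_(Z | half X Z) eps Z * E (vsum Z).
  apply/eqP; rewrite -subr_eq0 mulr_sumr -sumrB; apply/eqP.
  rewrite -[RHS]H => [|i Z iS hZ]; last first.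
    by rewrite g_refl // eps_refl // mulrN opprB addrC opprK.
  by apply: eq_bigr => Z _; rewrite mulrBl mulrA.
have L : \sum_(Z | half X Z) g Z * E (vsum Z) =
    \prod_(a in pos) (E (rt (sneg a)) - t * E (rt a)).
  under [LHS]eq_bigr do rewrite /g mulr_suml.
  rewrite exchange_big /= (bigD1 pos) ?pos_closed //= [X in _ + X]big1 ?addr0.
    rewrite expand ?pos_half //; apply: eq_bigr => Z _.
    by rewrite eps_pos mul1r.
  move=> Y /andP[cY neq].
  under eq_bigr do rewrite -mulrA.
  rewrite -mulr_sumr -expand ?closed_half_half //.
  have /subsetPn[i iS iY] : ~~ (S \subset Y).
    by apply: contraNN neq => /subsetP/(closed_half_simple cY)->.
  have iX := sys_sub sysX iS.
  have niY : sneg i \in Y by rewrite (half_neg (closed_half_half cY)).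
  (* The factor at the opposite of [i] is e^k - t e^(-k) = 0. *)
  rewrite (bigD1 (sneg i)) //= snegK EN /E (sys_ht sysX) // mulr1 -expRN -expRD.
  by rewrite [2 * k + - k](_ : _ = k) ?subrr ?mul0r ?mulr0 //; ring.
have Q : (-1) ^+ #|pos| * \sum_(Z | half X Z) eps Z * E (vsum Z) =
    \prod_(a in pos) (E (rt (sneg a)) - E (rt a)).
  under [RHS]eq_bigr do rewrite -[X in _ - X]mul1r.
  rewrite expand ?pos_half // mulr_sumr; apply: eq_bigr => Z hZ.
  by rewrite epsE // !mulrA -expr2 sqrr_sign mul1r.
have gpos : g pos = (-1) ^+ #|pos| * \sum_(Y | closed_half X Y) t ^+ #|Y :&: pos|.
  rewrite mulr_sumr; apply: eq_bigr => Y cY.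
  rewrite epsE ?closed_half_half // -mulrA setIC; congr (_ * _).
  by rewrite [in LHS](exprNn t) mulrA -expr2 sqrr_sign mul1r.
have {}H : \prod_(a in pos) (E (rt (sneg a)) - t * E (rt a)) =
    (\sum_(Y | closed_half X Y) t ^+ #|Y :&: pos|) *
    \prod_(a in pos) (E (rt (sneg a)) - E (rt a)).
  by rewrite -L H gpos -Q; ring.
pose e := \prod_(a in pos) E (rt a).
have eE u : e * \prod_(a in pos) (E (rt (sneg a)) - u * E (rt a)) =
    \prod_(a in pos) (1 - u * expR (2 * k * ht (rt a))).
  rewrite -big_split /=; apply: eq_bigr => a _.
  by rewrite EN E2 mulrBr divff // mulrCA.
rewrite -eE H mulrCA; congr (_ * _).
under [LHS]eq_bigr do rewrite -[X in 1 - X]mul1r.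
by rewrite -eE; congr (_ * _); apply: eq_bigr => a _; rewrite mul1r.
Qed.
End SimpleSystem.

(** * Generating polynomials at roots of unity *)

Section CyclotomicFactors.

Lemma one_subXn_neq0 (K : idomainType) n : (0 < n)%N -> 1 - 'X^n != 0 :> {poly K}.
Proof.
move=> n0; apply/eqP => /(congr1 (fun p : {poly K} => p`_0)).
rewrite coefB coef1 coefXn coef0; case: n n0 => //= n _.
by rewrite subr0 => /eqP; rewrite oner_eq0.
Qed.

(** A double root would annihilate the derivative, which vanishes at most at 0. *)
Lemma mup_one_subXn (z : algC) n : (0 < n)%N ->
  mup z (1 - 'X^n) = (z ^+ n == 1) :> nat.
Proof.
move=> n0; have nz := @one_subXn_neq0 algC _ n0.
have rE : root (1 - 'X^n) z = (z ^+ n == 1).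
  by rewrite /root !hornerE subr_eq0 eq_sym.
have [z1|z1] := boolP (z ^+ n == 1); last by rewrite mupNroot // rE.
have z0 : z != 0.
  by apply: contraTneq z1 => ->; rewrite expr0n gtn_eqF //= eq_sym oner_eq0.
apply/eqP; rewrite eqn_leq mup_leq // -XsubC_dvd // dvdp_XsubCl rE z1 andbT.
apply/negP => /dvdpP[q E].
have := congr1 (fun p : {poly algC} => (p^`()).[z]) E.
rewrite expr2 !derivE sub0r hornerN !(hornerXsubC, hornerM, hornerD) subrr.
rewrite !(mulr0, mul0r, addr0).
move=> /eqP; rewrite oppr_eq0 hornerMn hornerXn mulrn_eq0 expf_eq0 (negPf z0) andbF orbF.
by rewrite gtn_eqF.
Qed.

Lemma mup_prod_one_subXn (I : finType) (G : {set I}) (h : I -> nat) (z : algC) :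
  (forall a, a \in G -> (0 < h a)%N) ->
  mup z (\prod_(a in G) (1 - 'X^(h a))) = (\sum_(a in G) (z ^+ h a == 1)%R)%N.
Proof.
move=> h0.
suff [] : \prod_(a in G) (1 - 'X^(h a)) != 0 :> {poly algC} /\
  mup z (\prod_(a in G) (1 - 'X^(h a))) = (\sum_(a in G) (z ^+ h a == 1)%R)%N by [].
elim/big_rec2: _ => [|a m p aG [p0 E]].
  by rewrite oner_neq0 mupNroot // root1.
have nz := @one_subXn_neq0 algC _ (h0 _ aG).
by rewrite mulf_neq0 // mupM // E mup_one_subXn ?h0.
Qed.

(* At a root of unity [z != 1] of order dividing [H + 1], the symmetry        *)
(* [h (dual a) = H - h a] makes both products vanish to the same order, which *)
(* forces [A + 'X * B] to vanish at [z].                                      *)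
Lemma ideal_poly_core (I : finType) (G : {set I}) (h : I -> nat) (dual : I -> I)
    (A B : {poly int}) (m : int) (d H : nat) :
  (forall a, a \in G -> (0 < h a)%N) ->
  involutive dual -> (forall a, (dual a \in G) = (a \in G)) ->
  (forall a, a \in G -> (h (dual a) + h a)%N = H) ->
  (forall i, (d < i)%N -> A`_i = 0) -> A`_d = m ->
  (forall i, (i < d)%N -> B`_i = 0) -> (forall i, (d.*2 < i)%N -> B`_i = 0) ->
  B`_d = m -> (d < H)%N ->
  (A + 'X * B) * \prod_(a in G) (1 - 'X^(h a)) * (1 - 'X^H) =
    \prod_(a in G) (1 - 'X^((h a).+1)) * (1 - 'X^(H.+1)) ->
  (A + B - m *: 'X^d) * \prod_(a in G) (1 - 'X^(h a)) =
    \prod_(a in G) (1 - 'X^((h a).+1)).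
Proof.
move=> h0 dualK dualG dualh A_hi A_d B_lo B_hi B_d ltdH E.
have H0 : (0 < H)%N by apply: leq_trans ltdH.
pose c (p : {poly int}) := map_poly (intr : int -> algC) p.
have evD p q z : (c (p + q)).[z] = (c p).[z] + (c q).[z].
  by rewrite /c rmorphD hornerD.
have evN p z : (c (- p)).[z] = - (c p).[z] by rewrite /c rmorphN hornerN.
have evM p q z : (c (p * q)).[z] = (c p).[z] * (c q).[z].
  by rewrite /c rmorphM hornerM.
have evXn k z : (c 'X^k).[z] = z ^+ k by rewrite /c rmorphXn /= map_polyX hornerXn.
have ev1 z : (c 1).[z] = 1 by rewrite /c rmorph1 hornerC.
have root_AB z : z ^+ H.+1 = 1 -> z != 1 -> (c (A + 'X * B)).[z] = 0.
  move=> zH z1; apply/eqP; rewrite -/(root _ _).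
  have [->|AB0] := eqVneq (c (A + 'X * B)) 0; first exact: root0.
  have cM p q : c (p * q) = c p * c q by exact: rmorphM.
  have c1X i : c (1 - 'X^i) = 1 - 'X^i.
    by rewrite /c rmorphB rmorph1 rmorphXn /= map_polyX.
  have c_prod (k : I -> nat) :
      c (\prod_(a in G) (1 - 'X^(k a))) = \prod_(a in G) (1 - 'X^(k a)).
    by rewrite /c rmorph_prod; apply: eq_bigr => a _; exact: c1X.
  have E' := congr1 c E; rewrite !cM !c1X c_prod (c_prod (fun a => (h a).+1)) in E'.
  have nX : \prod_(a in G) (1 - 'X^(h a)) != 0 :> {poly algC}.
    by apply/prodf_neq0 => a aG; rewrite one_subXn_neq0 ?h0.
  have nY : \prod_(a in G) (1 - 'X^((h a).+1)) != 0 :> {poly algC}.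
    by apply/prodf_neq0 => a aG; rewrite one_subXn_neq0.
  (* Once the two products cancel, [1 - 'X^H] contributes 0 and [1 - 'X^(H.+1)] contributes 1, so
     [z] is a root of [A + 'X * B]. *)
  have := congr1 (mup z) E'; rewrite !mupM ?mulf_neq0 ?one_subXn_neq0 //.
  rewrite !mup_prod_one_subXn // !mup_one_subXn // zH eqxx.
  have zu : z * z ^+ H = 1 by rewrite -exprS.
  have -> : (z ^+ H == 1) = false.
    by apply: contraNF z1 => /eqP zH1; rewrite -zu zH1 mulr1.
  have -> : (\sum_(a in G) (z ^+ (h a).+1 == 1)%R =
             \sum_(a in G) (z ^+ h a == 1)%R)%N.
    rewrite [RHS](reindex_inj (inv_inj dualK)) /=.
    apply: eq_big => [a|a aG]; first by rewrite dualG.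
    have : z ^+ (h (dual a)) * z ^+ (h a).+1 = 1 by rewrite -exprD addnS dualh.
    move=> zz; congr (nat_of_bool _); apply/eqP/eqP => z'; move: zz; rewrite z'.
      by rewrite mulr1.
    by rewrite mul1r.
  rewrite addn0 addnC => /addnI mu1.
  by rewrite -dvdp_XsubCl XsubC_dvd // mu1.
pose S : {poly int} := \sum_(i < H.+1) 'X^i.
have SE : ('X - 1) * S = 'X^(H.+1) - 1 by rewrite -subrX1.
pose Q := B + 'X^H * A - m *: ('X^d * S).
have S_coef i : S`_i = (i < H.+1)%N%:R.
  rewrite coef_sum; have [lt|le] := ltnP i H.+1.
    rewrite (bigD1 (Ordinal lt)) //= coefXn eqxx big1 ?addr0 // => j neq.
    rewrite coefXn (_ : (i == j) = false) //; apply: contraNF neq => /eqP ij.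
    by apply/eqP/val_inj; rewrite /= ij.
  rewrite big1 // => j _; rewrite coefXn gtn_eqF //.
  exact: leq_trans (ltn_ord j) le.
(* [B] starts in degree d and ['X^H * A] ends in degree d + H; at both ends the coefficient m is
   cancelled by [m *: ('X^d * S)], and d < H keeps [A] and [B] from interfering there. *)
have Q_coef i : (i <= d)%N || (d + H <= i)%N -> Q`_i = 0.
  rewrite coefB coefD coefXnM coefZ coefXnM S_coef.
  move=> /orP[le|ge].
    rewrite (leq_ltn_trans le ltdH) addr0; move: le; rewrite leq_eqVlt => /orP[/eqP->|lt].
      by rewrite ltnn subnn B_d mulr1 subrr.
    by rewrite lt B_lo // mulr0 subrr.
  have -> : (i < H)%N = false by lia.
  have -> : (i < d)%N = false by lia.
  rewrite B_hi ?add0r; last by lia.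
  move: ge; rewrite leq_eqVlt => /orP[/eqP<-|gt].
    by rewrite addnK addKn A_d ltnSn mulr1 subrr.
  have -> : (i - d < H.+1)%N = false by lia.
  by rewrite A_hi ?mulr0 ?subrr //; lia.
(* At most H - 1 coefficients remain, fewer than the H nontrivial (H+1)-th roots of unity, where
   [Q'] vanishes. *)
pose Q' : {poly int} := \poly_(i < H.-1) Q`_(i + d.+1).
have QE : Q = 'X^(d.+1) * Q'.
  apply/polyP => i; rewrite coefXnM; case: ltnP => [lt|le].
    by rewrite Q_coef // -ltnS lt.
  rewrite coef_poly subnK //; case: ltnP => // le'.
  by rewrite Q_coef //; lia.
have [z z_prim] := C_prim_root_exists (ltn0Sn H).
have Q'0 : Q' = 0.
  apply: (@map_inj_poly _ _ (intr : int -> algC) (@intr_inj _) (rmorph0 _)).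
  rewrite [RHS]rmorph0.
  apply: (@roots_geq_poly_eq0 _ _ [seq z ^+ i | i <- iota 1 H]).
  - apply/allP => y /mapP[i]; rewrite mem_iota add1n ltnS => /andP[i0 iH] ->.
    have zi : z ^+ i ^+ H.+1 = 1 by rewrite exprAC (prim_expr_order z_prim) expr1n.
    have zi1 : z ^+ i != 1.
      by rewrite -(prim_order_dvd z_prim) gtnNdvd.
    have x0 : z ^+ i != 0.
      apply/eqP => z0; move: zi; rewrite z0 expr0n /= => /eqP.
      by rewrite eq_sym oner_eq0.
    have := root_AB _ zi zi1; move: zi zi1 x0; set x := z ^+ i => xH x1 x0 AB.
    have Sx : (c S).[x] = 0.
      have := congr1 (fun p => (c p).[x]) SE.
      rewrite evM !evD !evN ev1 -['X]expr1 !evXn expr1 xH subrr.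
      by move/eqP; rewrite mulf_eq0 subr_eq0 (negPf x1) => /eqP.
    have := congr1 (fun p => x * (c p).[x]) QE.
    rewrite /Q -mul_polyC evD evN !evM evD evM !evXn Sx !mulr0 subr0 => EE.
    have : x * (x ^+ d.+1 * (c Q').[x]) = 0.
      rewrite -EE; move: AB; rewrite evD evM -['X]expr1 evXn expr1 => AB.
      by rewrite mulrDr mulrA -exprS xH mul1r addrC.
    by move/eqP; rewrite mulf_eq0 (negPf x0) mulf_eq0 expf_eq0 (negPf x0) andbF.
  - rewrite map_inj_in_uniq ?iota_uniq // => i j; rewrite !mem_iota => iH jH /eqP.
    rewrite (eq_prim_root_expr z_prim) !modn_small ?[(_ < H.+1)%N]ltnS; last 2 first.
    + by lia.
    + by lia.
    by move/eqP.
  rewrite size_map size_iota; apply: leq_trans (size_poly _ _) _.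
  by apply: leq_trans (size_poly _ _) _; exact: leq_pred.
have Q0 : B + 'X^H * A - m *: ('X^d * S) = 0 by rewrite -/Q QE Q'0 mulr0.
have key : (A + B - m *: 'X^d) * (1 - 'X^(H.+1)) = (A + 'X * B) * (1 - 'X^H).
  (* The difference of the two sides is [(1 - 'X) * Q]. *)
  apply/eqP; rewrite -subr_eq0; apply/eqP; rewrite -[RHS](mulr0 (1 - 'X)) -Q0.
  move: Q0 => _; rewrite -!mul_polyC.
  have -> : 'X^(H.+1) = 1 + ('X - 1) * S :> {poly int} by rewrite SE addrC subrK.
  have XS : 'X * 'X^H = 1 + ('X - 1) * S :> {poly int} by rewrite -exprS SE addrC subrK.
  ring: XS.
apply: (mulIf (@one_subXn_neq0 _ H.+1 (ltn0Sn H))).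
by rewrite -E mulrAC key; ring.
Qed.

End CyclotomicFactors.

(** * The grading by the highest root *)

Section Height.
Variables (R : realType) (V : vectType R) (n : nat) (P : n.-tuple V).

(** The height before taking the floor, a linear functional as [simple_system] demands. *)
Definition rht (v : V) : R := \sum_(i < n) coord P i v.

Fact rht_is_scalar : scalar rht.
Proof.
move=> k u v; rewrite /rht mulr_sumr -big_split; apply: eq_bigr => i _.
by rewrite linearP.
Qed.

HB.instance Definition _ := GRing.isLinear.Build R V R *%R rht rht_is_scalar.

End Height.

Lemma poly_eq_expR (R : realType) (p q : {poly int}) :
  (forall k : R, 0 < k ->
    (map_poly intr p).[expR (2 * k)] = (map_poly intr q).[expR (2 * k)]) ->
  p = q.
Proof.
move=> E; apply/eqP; rewrite -subr_eq0; apply/eqP.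
apply: (@map_inj_poly _ _ (intr : int -> R) (@intr_inj _) (rmorph0 _)).
rewrite [RHS]rmorph0; set r := map_poly _ _.
apply: (@roots_geq_poly_eq0 R r [seq expR (2 * i.+1%:R) | i <- iota 0 (size r)]).
- apply/allP => x /mapP[i _ ->]; rewrite /root /r rmorphB hornerD hornerN.
  by rewrite E ?subrr // ltr0n.
- rewrite map_inj_uniq ?iota_uniq // => i j /expR_inj/(mulfI _).
  by rewrite pnatr_eq0 => /(_ isT)/eqP; rewrite eqr_nat eqSS => /eqP.
by rewrite size_map size_iota.
Qed.

Section HighestRoot.
Variables (R : realType) (V : vectType R) (f : {dot V for idfun}).
Variables (D : {fset V}) (n : nat) (P : n.-tuple V) (theta : V).
Hypothesis rootD : root_system f D.
Hypothesis simpleP : simple_roots D P.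
Hypothesis highest : highest_root D P theta.
Local Notation T := (fset_sub_type D).
Local Notation ht := (rht P).
Local Notation srefl := (srefl rootD).
Local Notation sneg := (sneg rootD).
Implicit Types (a b c i : T) (I Y : {set T}) (v : V).

Lemma big_roots (A : Type) (idx : A) (op : Monoid.com_law idx) (s : seq V)
    (F : V -> A) :
  uniq s -> {subset s <= D} ->
  \big[op/idx]_(v <- s) F v = \big[op/idx]_(a : T | rt a \in s) F (rt a).
Proof.
move=> us sD; rewrite -(big_map (@rt R V D) (mem s)).
rewrite -[RHS]big_filter; apply: perm_big; apply: uniq_perm => //.
  by rewrite filter_uniq // map_inj_uniq ?index_enum_uniq //; exact: rt_inj.
move=> v; rewrite mem_filter; apply/idP/andP => [vs|[]//]; split=> //.
by apply/mapP; exists [` sD _ vs]; rewrite ?mem_index_enum.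
Qed.

Lemma nat_combP (s : seq V) v : uniq s -> {subset s <= D} ->
  nat_comb s v <-> ncomb [set a : T | rt a \in s] v.
Proof.
move=> us sD; split=> -[c ->].
  exists (c \o @rt R V D); rewrite big_roots //.
  by apply: eq_big => [a|a _]; rewrite ?inE // scaler_nat.
exists (fun u => oapp c 0%N (insub u)); rewrite big_roots //.
apply: eq_big => [a|a _]; first by rewrite inE.
by rewrite /rt valK scaler_nat.
Qed.

Definition simples : {set T} := [set a | rt a \in tval P].

Lemma uniq_simples : uniq P.
Proof. by have := basis_free (simple_basis simpleP); exact: free_uniq. Qed.

Lemma simple_system_roots : simple_system rootD ht setT simples.
Proof.
have fP := basis_free (simple_basis simpleP).
have PD := simple_root simpleP.
split=> [a b _ _|a _|a|x x0 i|a _]; rewrite ?inE //.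
- move=> /tnthP[j ->]; rewrite /= /rht (bigD1 j) //= (tnth_nth 0) coord_free // eqxx.
  rewrite big1 ?addr0 // => k /negPf kj; rewrite coord_free //.
  by rewrite eq_sym kj.
- pose y (v : V) := oapp x 0 (insub v).
  have : \sum_(j < n) y P`_j *: P`_j = 0.
    under eq_bigr do rewrite -tnth_nth.
    rewrite -(big_tuple _ _ P xpredT (fun v => y v *: v)) /=.
    rewrite (big_roots _ (fun v => y v *: v)) ?uniq_simples // -[RHS]x0.
    by apply: eq_big => [a|a _]; rewrite ?inE // /y /rt valK.
  move=> /(freeP fP) y0 /tnthP[j E]; have := y0 j.
  by rewrite /y -(tnth_nth 0) -E /rt valK.
have [h|h] := simple_comb simpleP (valP a); [left|right].
  by apply/nat_combP => //; exact: uniq_simples.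
by apply/nat_combP => //; exact: uniq_simples.
Qed.

Let sysD := simple_system_roots.
Local Notation pos := (positive ht [set: T]).

(** * Dominance and maximal length of the highest root *)

Definition theta_root : T := [` highest.1].

Lemma theta_rootE : rt theta_root = theta. Proof. by []. Qed.

Lemma le_theta a : ncomb simples (theta - rt a).
Proof.
apply/nat_combP; [exact: uniq_simples|exact: simple_root|].
exact: (highest.2 _ (valP a)).
Qed.

Lemma theta_nz : theta != 0.
Proof. exact: root_nz rootD theta_root. Qed.

(** Otherwise reflecting in [i] would give a root higher than theta. *)
Lemma theta_dominant i : i \in simples -> 0 <= f theta (rt i).
Proof.
move=> iS; rewrite leNgt; apply/negP => neg.
have [m [hm _]] := ncomb_ht sysD (le_theta (srefl i theta_root)).
have : ht (theta - rt (srefl i theta_root)) < 0.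
  rewrite sreflE linearB (ht_refl sysD) // theta_rootE opprB addrCA subrr addr0.
  rewrite dot_coroot mulrAC pmulr_rlt0 // divr_gt0 //.
  by rewrite dot_gt0 // (root_nz rootD).
by rewrite hm ltNge ler0n.
Qed.

Lemma dot_ncomb_ge0 v w : ncomb simples v ->
  (forall i, i \in simples -> 0 <= f w (rt i)) -> 0 <= f w v.
Proof.
move=> [c ->] dom; rewrite dot_sumr; apply: sumr_ge0 => i iS.
by rewrite dotZr mulr_ge0 // dom.
Qed.

(** The highest root [b] of the same length as [a] is dominant, so (theta, theta) - (b, b) = (theta,
    theta - b) + (b, theta - b) is nonnegative. *)
Lemma theta_longest a : f (rt a) (rt a) <= f theta theta.
Proof.
pose p b := f (rt b) (rt b) == f (rt a) (rt a).
have pa : p a by exact: eqxx.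
case: (Order.TotalTheory.arg_maxP (fun b : T => ht (rt b)) pa) => b /eqP pb bmax.
have dom i : i \in simples -> 0 <= f (rt b) (rt i).
  move=> iS; rewrite leNgt; apply/negP => neg.
  have /bmax : p (srefl i b) by rewrite /p !sreflE dot_reflection ?pb // (root_nz rootD).
  rewrite sreflE (ht_refl sysD) //= leNgt ltrBrDl gtrDr => /negP; apply.
  by rewrite dot_coroot mulrAC pmulr_rlt0 // divr_gt0 // dot_gt0 // (root_nz rootD).
rewrite -pb -subr_ge0.
have -> : f theta theta - f (rt b) (rt b) =
    f theta (theta - rt b) + f (rt b) (theta - rt b).
  by rewrite !dotDr !dotNr (dot_sym f (rt b) theta); ring.
by rewrite addr_ge0 // dot_ncomb_ge0 //;
  [exact: le_theta|exact: theta_dominant|exact: le_theta].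
Qed.

(** * The grading of the roots by theta *)

Definition deg a : int := Num.floor (f (rt a) (coroot f theta)).

Lemma degE a : (deg a)%:~R = f (rt a) (coroot f theta).
Proof. by apply/eqP; rewrite -intrEfloor (root_int rootD theta_root). Qed.

Lemma deg_sneg a : deg (sneg a) = - deg a.
Proof. by apply/eqP; rewrite -(eqr_int R) intrN !degE snegE dotNl. Qed.

Lemma deg_theta : deg theta_root = 2.
Proof. by apply/eqP; rewrite -(eqr_int R) degE coroot_self // theta_nz. Qed.

Lemma degD a b c : rt a + rt b + rt c = 0 -> deg a + deg b + deg c = 0.
Proof.
move=> E; apply/eqP; rewrite -(eqr_int R) !intrD !degE -!dotDl E.
by rewrite dot0l.
Qed.

Lemma deg_srefl i a : f (rt i) theta = 0 -> deg (srefl i a) = deg a.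
Proof.
move=> i0; apply/eqP; rewrite -(eqr_int R) !degE sreflE /reflection dotDl dotNl dotZl.
by rewrite [f (rt i) _]dot_coroot i0 mulr0 mul0r mulr0 subr0.
Qed.

Lemma deg_le2 a : deg a <= 2.
Proof.
rewrite -(ler_int R) degE dot_coroot ler_pdivrMr ?dot_gt0 ?theta_nz //.
rewrite ler_pM2l //; have := dot_ge0 f (rt a - theta).
rewrite dotDl !dotDr !dotNl !dotNr (dot_sym f theta) opprK.
by have := theta_longest a; lra.
Qed.

Lemma deg_eq2 a : deg a = 2 -> a = theta_root.
Proof.
move=> /(congr1 (fun m : int => m%:~R : R)); rewrite degE dot_coroot.
have tt : f theta theta != 0 by rewrite dot_eq0 theta_nz.
move=> /(canRL (divfK tt)).
move=> E; apply: rt_inj; rewrite theta_rootE; apply/eqP; rewrite -subr_eq0.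
rewrite -(dot_eq0 f); apply/eqP/le_anti; rewrite dot_ge0 andbT.
rewrite dotDl !dotDr !dotNl !dotNr (dot_sym f theta) opprK.
have := theta_longest a; have : f (rt a) theta = f theta theta by lra.
by move=> ->; lra.
Qed.

Lemma deg_ge a : -2 <= deg a.
Proof. by rewrite -[deg a]opprK -deg_sneg lerN2 deg_le2. Qed.

Lemma deg_eqN2 a : deg a = -2 -> a = sneg theta_root.
Proof.
by move=> E; rewrite -(@deg_eq2 (sneg a)) ?snegK // deg_sneg E.
Qed.

Lemma deg_pos a : a \in pos -> 0 <= deg a.
Proof.
move=> ap; rewrite -(ler_int R) degE dot_coroot mulrAC dot_sym mulr_ge0 //.
  by rewrite divr_ge0 // dot_ge0.
by rewrite dot_ncomb_ge0 //; [exact: (pos_comb sysD)|exact: theta_dominant].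
Qed.

Lemma pos_deg a : 0 < deg a -> a \in pos.
Proof.
move=> a0; apply: contraT; rewrite -(pos_neg sysD (in_setT a)) => /deg_pos.
by rewrite deg_sneg oppr_ge0 leNgt a0.
Qed.

Lemma deg_eq0 a : (deg a == 0) = (f (rt a) theta == 0).
Proof. by rewrite -(eqr_int R) degE coroot_eq0 // theta_nz. Qed.

(** * Roots orthogonal to theta and the quotient of two product formulas *)

Definition levi : {set T} := [set a | deg a == 0].
Definition levi_simples : {set T} := simples :&: levi.
Local Notation pos0 := (positive ht levi).

(** Theta pairs nonnegatively with every simple root, so the terms of a sum orthogonal to theta are
    orthogonal to it one by one. *)
Lemma ncomb_levi_deg0 v : ncomb simples v -> f v theta = 0 ->
  ncomb levi_simples v.
Proof.
move=> [c ->]; rewrite dot_suml => /eqP; rewrite psumr_eq0 => [|i iS]; last first.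
  by rewrite dotZl dot_sym mulr_ge0 // theta_dominant.
move=> /allP E; exists c; rewrite (big_setID levi) /= [X in _ + X]big1 ?addr0 //.
move=> i /setDP[iS]; rewrite inE deg_eq0 => i0.
have := E i (mem_index_enum _); rewrite iS /= dotZl mulf_eq0 (negPf i0) orbF.
by move=> /eqP->; rewrite scale0r.
Qed.

Lemma simple_system_levi : simple_system rootD ht levi levi_simples.
Proof.
split=> [a b|a /setIP[]//|a /setIP[aS _]|x x0 i iS|a].
- rewrite !inE => a0 /eqP <-; rewrite deg_srefl //; apply/eqP.
  by rewrite -deg_eq0.
- exact: (sys_ht sysD).
- have := @sys_free _ _ _ _ _ _ _ _ sysD (fun i => if i \in levi then x i else 0).
  move: (iS) => /setIP[iS' il] /(_ _ _ iS'); rewrite il; apply.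
  rewrite (big_setID levi) /= [X in _ + X]big1 ?addr0; last first.
    by move=> j /setDP[_ /negPf->]; rewrite scale0r.
  by rewrite -[RHS]x0; apply: eq_bigr => j /setIP[_ ->].
rewrite inE deg_eq0 => /eqP a0.
have [h|h] := sys_comb sysD (in_setT a); [left|right].
  exact: ncomb_levi_deg0.
by apply: ncomb_levi_deg0 => //; rewrite dotNl a0 oppr0.
Qed.

Let sys0 := simple_system_levi.

Definition upper_part : {set T} := [set a | 0 < deg a].

Lemma posI_levi : pos :&: levi = pos0.
Proof. by apply/setP => a; rewrite !inE andbC. Qed.

Lemma posD_levi : pos :\: levi = upper_part.
Proof.
apply/setP => a; rewrite [RHS]inE; apply/setDP/idP => [[/deg_pos + +]|a0].
  by rewrite inE lt_neqAle eq_sym => -> ->.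
by split; [exact: pos_deg|rewrite inE gt_eqF].
Qed.

Lemma closed_half_levi Y : closed_half rootD setT Y ->
  closed_half rootD levi (Y :&: levi).
Proof.
move=> cY; have hY := closed_half_half cY; apply/andP; split.
  apply/andP; split; first exact: subsetIr.
  apply/forall_inP => a a0.
  have na0 : sneg a \in levi by move: a0; rewrite !inE deg_sneg oppr_eq0.
  by rewrite !in_setI (half_neg hY (in_setT a)) a0 na0 !andbT.
apply/forall_inP => a /setIP[aY _]; apply/forall_inP => b /setIP[bY _].
by apply/forall_inP => c /setIP[cY' _]; exact: (closed_half_sum cY).
Qed.

(* Every half-system splits into its Levi part and the rest, and the second   *)
(* factor does not depend on the first; divide the two product formulas.      *)
Lemma coset_gen_fun (k : R) : 0 < k ->
  (\sum_(Y | closed_half rootD setT Y && (Y :&: levi == pos0))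
      expR (2 * k) ^+ #|Y :&: upper_part|) *
    \prod_(a in upper_part) (1 - expR (2 * k * ht (rt a))) =
  \prod_(a in upper_part) (1 - expR (2 * k) * expR (2 * k * ht (rt a))).
Proof.
move=> k0; set t := expR (2 * k).
pose q Y0 := \sum_(Y | closed_half rootD setT Y && (Y :&: levi == Y0))
      t ^+ #|Y :&: upper_part|.
have q_refl i Y0 : i \in levi_simples -> closed_half rootD levi Y0 ->
    q (srefl i @^-1: Y0) = q Y0.
  move=> iS0 _; have /setIP[iS il] := iS0.
  have i0 : f (rt i) theta = 0 by apply/eqP; rewrite -deg_eq0; rewrite inE in il.
  rewrite /q (reindex_inj (inv_inj (preimset_sreflK rootD i))) /=.
  apply: eq_big => [Y|Y _].
    rewrite (closed_half_refl_eq sysD) //; congr (_ && _).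
    rewrite (_ : _ :&: _ = srefl i @^-1: (Y :&: levi)).
      exact: (inj_eq (inv_inj (preimset_sreflK rootD i))).
    by apply/setP => a; rewrite !inE deg_srefl.
  rewrite -(card_preimset (Y :&: _) (inv_inj (sreflK rootD i))); congr (_ ^+ _).
  by apply: eq_card => a; rewrite !inE deg_srefl.
have E := closed_half_gen_fun sysD k; have E0 := closed_half_gen_fun sys0 k.
have F : \sum_(Y | closed_half rootD setT Y) t ^+ #|Y :&: pos| =
   (\sum_(Y | closed_half rootD levi Y) t ^+ #|Y :&: pos0|) * q pos0.
  rewrite (partition_big (fun Y => Y :&: levi) (closed_half rootD levi)) /=; last first.
    by move=> Y; exact: closed_half_levi.
  rewrite mulr_suml; apply: eq_bigr => Y0 cY0.
  rewrite -(closed_half_const sys0 q_refl cY0) mulr_sumr; apply: eq_bigr.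
  move=> Y /andP[_ /eqP <-]; rewrite -exprD; congr (_ ^+ _).
  rewrite -(cardsID levi (Y :&: pos)) -posI_levi -posD_levi; congr addn.
    by rewrite setIACA setIid.
  by rewrite setIDA.
rewrite -/t in E E0 *; rewrite -/(q pos0).
have split_prod (g : T -> R) : \prod_(a in pos) g a =
    \prod_(a in pos0) g a * \prod_(a in upper_part) g a.
  by rewrite (big_setID levi) /= posI_levi posD_levi.
move: E; rewrite F !split_prod -E0 => E.
have nz : (\sum_(Y | closed_half rootD levi Y) t ^+ #|Y :&: pos0|) *
   \prod_(a in pos0) (1 - expR (2 * k * ht (rt a))) != 0.
  rewrite E0; apply/prodf_neq0 => a /(pos_gt0) a0.
  rewrite -expRD subr_eq0 eq_sym gt_eqF // expR_gt1.
  by rewrite addr_gt0 ?mulr_gt0.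
by apply: (mulfI nz); rewrite -E; ring.
Qed.

(** * Upper ideals of grade 1 and their duality *)

Definition grade1 : {set T} := [set a | deg a == 1].

Definition upper I : Prop := I \subset grade1 /\
  forall a b, a \in I -> b \in grade1 -> ncomb levi_simples (rt b - rt a) -> b \in I.

(** Built from reflections so as to be a root for every [a]; on grade 1 it is theta - a
    ([dualE]). *)
Definition dual a : T := sneg (srefl theta_root a).

Lemma deg_dual a : deg (dual a) = deg a.
Proof.
apply/eqP; rewrite -(eqr_int R) !degE snegE sreflE /reflection theta_rootE.
rewrite dotNl dotDl dotNl dotZl coroot_self ?theta_nz //.
by apply/eqP; ring.
Qed.

Lemma dualK : involutive dual.
Proof. by move=> a; rewrite /dual srefl_neg snegK sreflK. Qed.

Lemma dualE a : deg a = 1 -> rt (dual a) = theta - rt a.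
Proof.
move=> a1; rewrite snegE sreflE /reflection theta_rootE -degE a1 scale1r.
by rewrite opprB.
Qed.

Lemma dual_grade1 a : (dual a \in grade1) = (a \in grade1).
Proof. by rewrite !inE deg_dual. Qed.

(** Suppose [I] contains a and dual a but neither b nor dual b. As a + dual a = theta and (theta, b)
    > 0, one of the former, c, has (c, b) > 0, so c - b is a root of grade 0. If it is positive,
    dual b lies above dual c; if negative, b lies above c: a contradiction either way. *)
Lemma upper_dichotomy I : upper I ->
  (forall a, a \in I -> dual a \notin I) \/
  (forall a, a \in grade1 -> a \notin I -> dual a \in I).
Proof.
move=> [sub up].
have [/forall_inP|/forall_inPn[a aI]] := boolP [forall a in I, dual a \notin I].
  by left.
rewrite negbK => daI; right=> b b1 nbI; apply: contraT => ndbI.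
have a1 := subsetP sub _ aI.
have key c : c \in I -> dual c \in I -> ~~ (0 < f (rt c) (rt b)).
  move=> cI dcI; apply/negP => cb.
  have c1 := subsetP sub _ cI; have neq : c != b by apply: contraNneq nbI => <-.
  have [e [eE _]] := root_string rootD cb neq.
  have e0 : f (rt e) theta = 0.
    apply/eqP; rewrite -deg_eq0 -(eqr_int R) degE eE dotDl dotNl -!degE.
    by move: c1 b1; rewrite !inE => /eqP-> /eqP->; rewrite subrr.
  have [h|h] := sys_comb sysD (in_setT e).
    move/negP: ndbI; apply; apply: (up _ _ dcI); first by rewrite dual_grade1.
    move: b1 c1; rewrite !inE => /eqP b1 /eqP c1; rewrite !dualE //.
    by rewrite opprB addrC addrA subrK -eE; exact: ncomb_levi_deg0.
  move/negP: nbI; apply; apply: (up _ _ cI) => //.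
  rewrite -opprB -eE; apply: ncomb_levi_deg0 => //.
  by rewrite dotNl e0 oppr0.
have := key _ daI; rewrite dualK aI => /(_ isT).
have := key _ aI daI; rewrite -!leNgt => h1 h2.
have : f theta (rt b) <= 0.
  have a1' : deg a = 1 by move: a1; rewrite inE => /eqP.
  have <- : rt a + rt (dual a) = theta by rewrite (dualE a1') addrC subrK.
  by rewrite dotDl -(addr0 0) lerD.
rewrite leNgt dot_sym -(coroot_gt0 f _ theta_nz) -degE.
by move: b1; rewrite inE => /eqP->; rewrite ltr01.
Qed.

(** * Upper ideals and positive systems *)

Definition disjoint_ideal I : bool :=
  `[< upper I >] && [forall a in I, dual a \notin I].

Definition covering_ideal I : bool :=
  `[< upper I >] && [forall a in grade1, (a \in I) || (dual a \in I)].

(* [true] and [false] tell whether the half-system contains the highest root. *)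
Definition half_of_ideal (e : bool) I : {set T} :=
  [set a | if deg a == 0 then 0 < ht (rt a) else
           if deg a == 1 then a \in I else
           if deg a == -1 then sneg a \notin I else
           (deg a == 2) == e].

Let memh e I a : (a \in half_of_ideal e I) =
  (if deg a == 0 then 0 < ht (rt a) else
           if deg a == 1 then a \in I else
           if deg a == -1 then sneg a \notin I else
           (deg a == 2) == e).
Proof. by rewrite inE. Qed.

Let deg_cases a : deg a = 0 \/ deg a = 1 \/ deg a = -1 \/ deg a = 2 \/ deg a = -2.
Proof.
have := deg_le2 a; have := deg_ge a; clear; lia.
Qed.

Lemma half_of_ideal_half e I : half rootD setT (half_of_ideal e I).
Proof.
apply/andP; split; first exact: subsetT.
apply/forall_inP => a _; rewrite !memh deg_sneg snegK.
have := pos_neg sysD (in_setT a); rewrite !inE /= => E.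
by case: (deg_cases a) => [|[|[|[|]]]] ->; rewrite /= ?E ?negbK //; case: e.
Qed.

(** Sorted degrees of three roots with sum zero fall into five patterns. Heights exclude (0, 0, 0),
    the ideal property (1, 0, -1), disjointness (1, 1, -2), covering (2, -1, -1), and the single
    sign of theta (2, 0, -2). *)
Lemma half_of_ideal_closed e I : upper I ->
  (if e then forall a, a \in grade1 -> a \notin I -> dual a \in I
   else forall a, a \in I -> dual a \notin I) ->
  closed_half rootD setT (half_of_ideal e I).
Proof.
move=> [sub up] cond; set Y := half_of_ideal e I.
have hY : half rootD setT Y := half_of_ideal_half e I.
have memY a : a \in Y = _ := memh e I a.
suff key a b c : deg c <= deg b -> deg b <= deg a -> a \in Y -> b \in Y ->
    c \in Y -> rt a + rt b + rt c != 0.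
  rewrite /closed_half hY; apply/forall_inP => a aY; apply/forall_inP => b bY.
  apply/forall_inP => c cY.
  have [ab|/ltW ab] := lerP (deg a) (deg b);
  have [bc|/ltW bc] := lerP (deg b) (deg c);
  have [ac|/ltW ac] := lerP (deg a) (deg c).
  - by rewrite addrC addrA addrAC key // addrC.
  - by rewrite addrC addrA addrAC key // addrC.
  - by rewrite (addrC (rt a)) -addrA (addrC (rt a)) addrA key.
  - by rewrite (addrC (rt a)) key.
  - by rewrite addrC addrA key.
  - by rewrite addrAC key.
  - by rewrite key.
  - by rewrite key.
move=> cb ba aY bY cY; apply/eqP => E; have dE := degD E.
have cE : rt (sneg c) = rt a + rt b.
  by rewrite snegE; apply/eqP; rewrite eq_sym -addr_eq0 E.
have cases : (deg a = 0 /\ deg b = 0 /\ deg c = 0) \/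
   (deg a = 1 /\ deg b = 0 /\ deg c = -1) \/
   (deg a = 1 /\ deg b = 1 /\ deg c = -2) \/
   (deg a = 2 /\ deg b = -1 /\ deg c = -1) \/
   (deg a = 2 /\ deg b = 0 /\ deg c = -2).
  move: dE cb ba (deg_le2 a) (deg_ge c) (deg_le2 b) (deg_ge b); clear; lia.
move: aY bY cY; rewrite !memY; case: cases => [|[|[|[|]]]] [a1 [b1 c1]]; rewrite a1 b1 c1 /=.
- move=> a0 b0 c0; have : 0 < ht (rt a + rt b + rt c) by rewrite !linearD !addr_gt0.
  by rewrite E linear0 ltxx.
- move=> aI b0 /negP; apply; apply: (up _ _ aI); first by rewrite inE deg_sneg c1.
  rewrite cE addrC addKr; apply: (pos_comb sys0).
  by rewrite !inE b1 eqxx.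
- move=> aI bI /eqP e0; move: cond; rewrite -e0 => /(_ _ aI)/negP; apply.
  suff -> : dual a = b by [].
  apply: rt_inj; rewrite dualE // -[theta]theta_rootE.
  have -> : theta_root = sneg c by rewrite (deg_eqN2 c1) snegK.
  by rewrite cE addrC addKr.
- move=> /eqP e1 bI cI; move: cond; rewrite -e1 => /(_ (sneg b)).
  rewrite inE deg_sneg b1 bI => /(_ isT isT); apply/negP.
  suff -> : dual (sneg b) = sneg c by [].
  apply: rt_inj; rewrite dualE ?deg_sneg ?b1 // snegE opprK cE.
  by rewrite (deg_eq2 a1).
by move=> /eqP<- _.
Qed.

(** Closure under adding grade 0 simple roots suffices if b is reached from a through roots. Some
    simple [i] used in b - a has (b - a, i) > 0, so (b, i) > 0 and b - i is a root, or (a, i) < 0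
    and a + i is one; induct on the number of simple roots in b - a. *)
Lemma ideal_of_closed_half Y : closed_half rootD setT Y -> Y :&: levi = pos0 ->
  upper (Y :&: grade1).
Proof.
move=> cY Y0; split; first exact: subsetIr.
have hY := closed_half_half cY.
have step a b i : a \in Y -> i \in levi_simples -> rt b = rt a + rt i -> b \in Y.
  move=> aY i0 E; have : i \in pos0 by exact: (simple_pos sys0).
  rewrite -Y0 => /setIP[iY _]; apply: contraT => bY.
  have := closed_half_sum cY aY iY; rewrite -E => /(_ (sneg b)).
  by rewrite (half_neg hY (in_setT b)) bY snegE subrr eqxx => /(_ isT).
move=> a b /setIP[aY a1] b1 [c E]; rewrite in_setI b1 andbT.
have [m] := ubnP (\sum_(i in levi_simples) c i)%N.
elim: m => // m IH in a b c aY a1 b1 E *; rewrite ltnS => le_m.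
have [|nz] := boolP (rt b - rt a == 0).
  by rewrite subr_eq0 => /eqP/rt_inj->.
have /exists_inP[i i0 /andP[ci bi]] :
    [exists i in levi_simples, (0 < c i)%N && (0 < f (rt b - rt a) (rt i))].
  apply: contraT => /exists_inPn none; have := dot_gt0 f nz.
  rewrite {2}E dot_sumr ltNge sumr_le0 // => i /none.
  rewrite dotZr negb_and -leqNgt leqn0 => /orP[/eqP->|]; first by rewrite mul0r.
  by rewrite -leNgt => h; rewrite mulr_ge0_le0.
have [iS il] := setIP i0; rewrite inE in il.
pose c' j := (c j - (j == i))%N.
have c'E : \sum_(j in levi_simples) (c' j)%:R *: rt j = rt b - rt a - rt i.
  rewrite E (bigD1 i) //= [in RHS](bigD1 i) //= /c' eqxx natrB // scalerBl scale1r.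
  rewrite addrAC; congr (_ + _ - _); apply: eq_bigr => j /andP[_ /negPf->].
  by rewrite subn0.
have lt_m : (\sum_(j in levi_simples) c' j < m)%N.
  apply: leq_trans le_m; rewrite (bigD1 i) //= [X in (_ < X)%N](bigD1 i) //=.
  rewrite /c' eqxx -addSn subn1 prednK // leq_add2l; apply: leq_sum => j _.
  exact: leq_subr.
have deg_i (v w : T) u : deg v = 1 -> rt w = rt v + u -> f u theta = 0 -> deg w = 1.
  move=> v1 wE u0; apply/eqP; rewrite -(eqr_int R) degE wE dotDl -degE v1.
  by rewrite dot_coroot u0 mulr0 mul0r addr0.
have i00 : f (rt i) theta = 0 by apply/eqP; rewrite -deg_eq0.
move: bi; rewrite dotDl dotNl subr_gt0.
have [lt0b _|le0] := ltP 0 (f (rt b) (rt i)).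
  have nbi : b != i by apply: contraTneq b1 => ->; rewrite inE (eqP il).
  have [b' [b'E _]] := root_string rootD lt0b nbi.
  apply: (step b' _ i) => //; last by rewrite b'E subrK.
  apply: (IH a b' c') => //; last by rewrite c'E b'E addrAC.
  move: b1; rewrite !inE => /eqP b1; apply/eqP; apply: (deg_i b _ (- rt i)) => //.
  by rewrite dotNl i00 oppr0.
move=> lta; have ai : 0 < f (rt a) (rt (sneg i)).
  by rewrite snegE dotNr oppr_gt0; exact: lt_le_trans lta le0.
have nai : a != sneg i.
  by apply: contraTneq a1 => ->; rewrite inE deg_sneg (eqP il).
have [a' []] := root_string rootD ai nai.
rewrite snegE opprK => a'E _.
apply: (IH a' b c') => //; first exact: (step a _ i).
  by move: a1; rewrite !inE => /eqP a1; apply/eqP; apply: (deg_i a _ (rt i)).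
by rewrite c'E a'E opprD addrA.
Qed.

Lemma half_of_idealK e I : I \subset grade1 -> half_of_ideal e I :&: grade1 = I.
Proof.
move=> /subsetP sub; apply/setP => a; rewrite in_setI memh [a \in grade1]inE.
have [->|na] := eqVneq (deg a) 1; first by rewrite andbT.
by rewrite andbF; apply/esym; apply: contraNF na => /sub; rewrite inE.
Qed.

Lemma half_of_ideal_levi e I : half_of_ideal e I :&: levi = pos0.
Proof.
by apply/setP => a; rewrite in_setI memh !inE; case: eqP; rewrite ?andbT ?andbF.
Qed.

Lemma half_of_ideal_theta e I : (theta_root \in half_of_ideal e I) = e.
Proof. by rewrite memh deg_theta. Qed.

Lemma ideal_of_halfK Y : half rootD setT Y -> Y :&: levi = pos0 ->
  half_of_ideal (theta_root \in Y) (Y :&: grade1) = Y.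
Proof.
move=> hY Y0; apply/setP => a; rewrite memh.
have gr b : deg b = 1 -> (b \in Y :&: grade1) = (b \in Y).
  by move=> b1; rewrite in_setI [b \in grade1]inE b1 andbT.
case: (deg_cases a) => [|[|[|[|]]]] a1; rewrite a1 /=.
- have : (a \in Y :&: levi) = (a \in pos0) by rewrite Y0.
  by rewrite in_setI !inE a1 andbT.
- by rewrite gr.
- by rewrite gr ?deg_sneg ?a1 // (half_neg hY (in_setT a)) negbK.
- by rewrite (deg_eq2 a1) eq_sym eqb_id.
by rewrite (deg_eqN2 a1) (half_neg hY (in_setT _)) eq_sym eqbF_neg.
Qed.

Lemma upper_partE : upper_part = theta_root |: grade1.
Proof.
apply/setP => a; rewrite in_setU1 /upper_part /grade1 !inE.
have [->|na] := eqVneq a theta_root; first by rewrite deg_theta.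
have : deg a <> 2 by move=> /deg_eq2/eqP; apply/negP.
by move: (deg_le2 a); clear; lia.
Qed.

Lemma card_upper_part Y :
  #|Y :&: upper_part| = (#|Y :&: grade1| + (theta_root \in Y))%N.
Proof.
have ntheta : theta_root \notin grade1 by rewrite inE deg_theta.
rewrite upper_partE setIUr cardsU addnC -setIIr.
rewrite [[set theta_root] :&: grade1](_ : _ = set0) ?setI0 ?cards0 ?subn0; last first.
  by apply/eqP; rewrite setI_eq0 disjoints1.
congr addn; have [tY|tY] := boolP (theta_root \in Y).
  by rewrite (setIidPr _) ?sub1set // cards1.
by apply/eqP; rewrite cards_eq0 setI_eq0 disjoint_sym disjoints1.
Qed.

(** Split by the sign of theta, which also accounts for the factor [t]. Closure applied to a, dual
    a, -theta gives disjointness; applied to -a, -dual a, theta it gives covering. *)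
Lemma sum_closed_halves (K : comNzRingType) (t : K) :
  \sum_(Y | closed_half rootD setT Y && (Y :&: levi == pos0))
      t ^+ #|Y :&: upper_part| =
  \sum_(I | disjoint_ideal I) t ^+ #|I| + t * \sum_(I | covering_ideal I) t ^+ #|I|.
Proof.
rewrite (bigID (fun Y => theta_root \in Y)) /= addrC; congr (_ + _).
  rewrite (reindex_onto (half_of_ideal false) (fun Y => Y :&: grade1)) /=; last first.
    move=> Y /andP[/andP[cY /eqP Y0] /negPf tY].
    by rewrite -{1}tY ideal_of_halfK // closed_half_half.
  apply: eq_big => [I|I].
    rewrite half_of_ideal_theta andbT half_of_ideal_levi eqxx andbT.
    apply/andP/andP => -[cI Ie].
      have := ideal_of_closed_half cI (half_of_ideal_levi _ _).
      rewrite (eqP Ie) => up; split; first exact/asboolP.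
      have hI := closed_half_half cI.
      apply/forall_inP => a aI; apply/negP => daI.
      have a1 : deg a = 1 by case: up => /subsetP/(_ _ aI); rewrite inE => /eqP.
      have := closed_half_sum cI; rewrite -/(half_of_ideal false I).
      move=> /(_ a (dual a) (sneg theta_root)).
      rewrite (half_neg hI (in_setT _)) half_of_ideal_theta !memh deg_dual a1 /=.
      move=> /(_ aI daI isT); rewrite snegE dualE // theta_rootE.
      by rewrite [rt a + _]addrC subrK subrr eqxx.
    have up : upper I by exact/asboolP.
    split; last by rewrite half_of_idealK //; case: up.
    by apply: half_of_ideal_closed => //= a; exact: (forall_inP Ie).
  move=> /andP[/andP[_ tY] /eqP IE].
  by rewrite card_upper_part (negPf tY) addn0 IE.
rewrite (reindex_onto (half_of_ideal true) (fun Y => Y :&: grade1)) /=; last first.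
  move=> Y /andP[/andP[cY /eqP Y0] tY].
  by rewrite -{1}tY ideal_of_halfK // closed_half_half.
rewrite mulr_sumr; apply: eq_big => [I|I].
  rewrite half_of_ideal_theta andbT half_of_ideal_levi eqxx andbT.
  apply/andP/andP => -[cI Ie].
    have := ideal_of_closed_half cI (half_of_ideal_levi _ _).
    rewrite (eqP Ie) => up; split; first exact/asboolP.
    have hI := closed_half_half cI.
    apply/forall_inP => a; rewrite inE => /eqP a1; apply: contraT.
    rewrite negb_or => /andP[aI daI].
    have := closed_half_sum cI => /(_ (sneg a) (sneg (dual a)) theta_root).
    rewrite (half_neg hI (in_setT a)) (half_neg hI (in_setT (dual a))).
    rewrite half_of_ideal_theta !memh deg_dual a1 /=.
    move=> /(_ aI daI isT); rewrite (snegE rootD a) (snegE rootD (dual a)) dualE // theta_rootE.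
    by rewrite opprB addrA addNr add0r addNr eqxx.
  have up : upper I by exact/asboolP.
  split; last by rewrite half_of_idealK //; case: up.
  apply: half_of_ideal_closed => //= a a1 aI.
  by have := forall_inP Ie _ a1; rewrite (negPf aI).
move=> /andP[/andP[_ tY] /eqP IE].
by rewrite card_upper_part tY addn1 exprS IE.
Qed.

(** * Heights and cardinalities in grade 1 *)

Definition htn a : nat := `|Defs.ht P (rt a)|.

Lemma htnP a : a \in pos ->
  [/\ (0 < htn a)%N, Defs.ht P (rt a) = (htn a)%:Z & ht (rt a) = (htn a)%:R].
Proof.
move=> ap; have [m m0 E] := pos_ht sysD ap.
have hE : (Defs.ht P (rt a))%:~R = m%:~R :> R.
  by rewrite (htE simpleP (valP a)) -pmulrn -E.
by rewrite /htn (intr_inj hE) /= E pmulrn.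
Qed.

Lemma htn_gt0 a : a \in grade1 -> (0 < htn a)%N.
Proof. by rewrite inE => /eqP a1; case: (@htnP a) => //; rewrite pos_deg ?a1. Qed.

Lemma htn_dual a : a \in grade1 -> (htn (dual a) + htn a)%N = htn theta_root.
Proof.
rewrite inE => /eqP a1.
have [|_ _ h1] := @htnP a; first by rewrite pos_deg ?a1.
have [|_ _ h2] := @htnP (dual a); first by rewrite pos_deg ?deg_dual ?a1.
have [|_ _ h3] := @htnP theta_root; first by rewrite pos_deg ?deg_theta.
apply/eqP; rewrite -(eqr_nat R) natrD -h1 -h2 -h3 dualE // theta_rootE.
by rewrite linearB subrK.
Qed.

Lemma dual_neq a : a \in grade1 -> dual a != a.
Proof.
rewrite inE => /eqP a1; apply/eqP => E.
have : rt theta_root = 2 *: rt a.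
  by rewrite theta_rootE scaler_nat mulr2n -{1}E dualE // subrK.
move=> /(root_prop rootD) [] /(congr1 deg); rewrite deg_theta ?deg_sneg a1 //.
Qed.

(** [dual] has no fixed point in grade 1; the enumeration order selects one root from each pair. *)
Definition half_card : nat := #|[set a in grade1 | (enum_rank a < enum_rank (dual a))%N]|.

Lemma card_grade1 : #|grade1| = half_card.*2.
Proof.
set L := [set a in grade1 | (enum_rank a < enum_rank (dual a))%N].
rewrite -(cardsID L) -addnn (setIidPr _); last first.
  by apply/subsetP => a; rewrite in_set => /andP[].
congr addn; rewrite /half_card -/L -[RHS](card_preimset _ (inv_inj dualK)).
apply: eq_card => a; rewrite in_setD !in_set dualK deg_dual.
have [a1|] := boolP (deg a == 1); rewrite ?andbF //=.
rewrite andbT -leqNgt leq_eqVlt (inj_eq val_inj) (inj_eq enum_rank_inj).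
by rewrite (negPf (dual_neq _)) // inE.
Qed.

Lemma card_dual I : #|dual @^-1: I| = #|I|.
Proof. by rewrite card_preimset //; exact: inv_inj dualK. Qed.

Lemma dual_sub I : I \subset grade1 -> dual @^-1: I \subset grade1.
Proof.
by move=> /subsetP sub; apply/subsetP => a; rewrite inE => /sub; rewrite dual_grade1.
Qed.

Lemma disjoint_idealE I :
  [forall a in I, dual a \notin I] = (I :&: dual @^-1: I == set0).
Proof.
apply/forall_inP/idP => [h|/eqP h a aI]; first apply/eqP.
  by apply/setP => a; rewrite !inE; have [/h/negPf->|] := boolP (a \in I).
by apply/negP => daI; have := in_set0 a; rewrite -h !inE aI daI.
Qed.

Lemma covering_idealE I : I \subset grade1 ->
  [forall a in grade1, (a \in I) || (dual a \in I)] = (I :|: dual @^-1: I == grade1).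
Proof.
move=> sub; rewrite eqEsubset subUset sub dual_sub //=.
by apply/forall_inP/subsetP => h a /h; rewrite in_setU inE.
Qed.

Lemma disjoint_ideal_card I : disjoint_ideal I -> (#|I| <= half_card)%N.
Proof.
move=> /andP[/asboolP[sub _]]; rewrite disjoint_idealE => /eqP E.
rewrite -leq_double -card_grade1 -addnn -{2}(card_dual I) -cardsUI E cards0 addn0.
by apply: subset_leq_card; rewrite subUset sub dual_sub.
Qed.

Lemma covering_ideal_card I : covering_ideal I -> (half_card <= #|I|)%N.
Proof.
move=> /andP[/asboolP[sub _]]; rewrite covering_idealE // => /eqP E.
by rewrite -leq_double -card_grade1 -addnn -{2}(card_dual I) -cardsUI E leq_addr.
Qed.

Lemma covering_ideal_le I : covering_ideal I -> (#|I| <= half_card.*2)%N.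
Proof. by move=> /andP[/asboolP[sub _] _]; rewrite -card_grade1 subset_leq_card. Qed.

(** The sizes of the union and the intersection of [I] with its dual add up to that of grade 1, so
    one is full exactly when the other is empty. *)
Lemma middle_ideal I : #|I| = half_card -> disjoint_ideal I = covering_ideal I.
Proof.
move=> cI; apply: andb_id2l => /asboolP[sub _].
rewrite disjoint_idealE covering_idealE //.
have := cardsUI I (dual @^-1: I); rewrite card_dual cI addnn -card_grade1 => E.
have sub' : I :|: dual @^-1: I \subset grade1 by rewrite subUset sub dual_sub.
have [_ <-] := subset_leqif_cards sub'; rewrite -cards_eq0.
by apply/eqP/eqP; move: E; clear; lia.
Qed.

Lemma ideal_cases I : `[< upper I >] = disjoint_ideal I || covering_ideal I.
Proof.
rewrite /disjoint_ideal /covering_ideal -andb_orr.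
have [up|//] := boolP `[< upper I >].
have /asboolP/upper_dichotomy [h|h] := up; apply/esym/orP; [left|right].
  exact/forall_inP.
by apply/forall_inP => a a1; case: (boolP (a \in I)) => //= aI; exact: h.
Qed.

(** Compute the pairing of 2 rho with the coroot of theta twice. Summing degrees gives 2 d + 2.
    Expanding theta in simple roots i with coefficients c_i gives the sum of 2 c_i (i, i) / (theta,
    theta), at most 2 ht theta because theta is longest. *)
Lemma half_card_lt : (half_card < htn theta_root)%N.
Proof.
have tt : 0 < f theta theta by rewrite dot_gt0 // theta_nz.
have [|_ _ hE] := @htnP theta_root; first by rewrite pos_deg ?deg_theta.
have E : f (vsum pos) (coroot f theta) = (half_card.*2 + 2)%:R.
  rewrite dot_suml; under eq_bigr do rewrite -degE.
  rewrite (big_setID levi) /= posD_levi upper_partE big1 ?add0r => [|a]; last first.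
    by rewrite !inE => /andP[_ /eqP->].
  rewrite big_setU1 /=; last by rewrite inE deg_theta.
  rewrite deg_theta (eq_bigr (fun=> 1)) => [|a]; last by rewrite inE => /eqP->.
  by rewrite sumr_const card_grade1 natrD addrC.
have [c] : ncomb simples (rt theta_root).
  by apply: (pos_comb sysD); rewrite pos_deg ?deg_theta.
rewrite theta_rootE => cE.
have : f (vsum pos) (coroot f theta) <= 2 * ht theta.
  rewrite dot_coroot ler_pdivrMr // {1 2}cE dot_sumr (ht_comb sysD) -mulrA.
  rewrite ler_pM2l // mulr_suml; apply: ler_sum => i iS; rewrite dotZr.
  rewrite ler_wpM2l //; apply: le_trans (theta_longest i).
  have := vsum_pos sysD iS; rewrite dot_coroot.
  have nz : f (rt i) (rt i) != 0 by rewrite dot_eq0 (root_nz rootD).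
  by move=> /(canRL (divfK nz)); lra.
by rewrite E -theta_rootE hE -natrM ler_nat; lia.
Qed.

(** * The generating polynomial of the upper ideals *)

Lemma coset_gen_fun_nat (k : R) : 0 < k -> let t := expR (2 * k) in
  (\sum_(I | disjoint_ideal I) t ^+ #|I| + t * \sum_(I | covering_ideal I) t ^+ #|I|) *
    \prod_(a in grade1) (1 - t ^+ htn a) * (1 - t ^+ htn theta_root) =
  \prod_(a in grade1) (1 - t ^+ (htn a).+1) * (1 - t ^+ (htn theta_root).+1).
Proof.
move=> k0 t; have := coset_gen_fun k0; rewrite sum_closed_halves upper_partE.
have ntheta : theta_root \notin grade1 by rewrite inE deg_theta.
rewrite !big_setU1 //= -/t.
have e a : 0 < deg a -> expR (2 * k * ht (rt a)) = t ^+ htn a.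
  by move=> a0; have [|_ _ ->] := @htnP a; rewrite ?pos_deg // expRM_natr.
rewrite e ?deg_theta // -exprS.
have -> : \prod_(a in grade1) (1 - expR (2 * k * ht (rt a))) =
    \prod_(a in grade1) (1 - t ^+ htn a).
  by apply: eq_bigr => a; rewrite inE => /eqP a1; rewrite e ?a1.
have -> : \prod_(a in grade1) (1 - t * expR (2 * k * ht (rt a))) =
    \prod_(a in grade1) (1 - t ^+ (htn a).+1).
  by apply: eq_bigr => a; rewrite inE => /eqP a1; rewrite e ?a1 // exprS.
by move=> E; rewrite -mulrA [X in _ * X]mulrC E mulrC.
Qed.

Lemma ideal_gen_fun :
  (\sum_(I | `[< upper I >]) 'X^#|I|) * \prod_(a in grade1) (1 - 'X^(htn a)) =
  \prod_(a in grade1) (1 - 'X^((htn a).+1)) :> {poly int}.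
Proof.
pose A : {poly int} := \sum_(I | disjoint_ideal I) 'X^#|I|.
pose B : {poly int} := \sum_(I | covering_ideal I) 'X^#|I|.
have coefS (p : pred {set T}) (i : nat) : (\sum_(I | p I) 'X^#|I| : {poly int})`_i =
    \sum_(I | p I && (#|I| == i)) 1.
  rewrite coef_sum big_mkcondr; apply: eq_bigr => I _.
  by rewrite coefXn eq_sym; case: eqP.
have coef0 (p : pred {set T}) (i : nat) : (forall I, p I -> #|I| != i) ->
    (\sum_(I | p I) 'X^#|I| : {poly int})`_i = 0.
  by move=> h; rewrite coefS big_pred0 // => I; case: (boolP (p I)) => //= /h/negPf.
(* Inclusion-exclusion: the ideals of both kinds are those of the first kind with exactly d
   elements, counted by the coefficient of [A] in degree d. *)
have -> : \sum_(I | `[< upper I >]) 'X^#|I| = A + B - A`_half_card *: 'X^half_card.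
  have -> : A`_half_card *: 'X^half_card =
      \sum_(I | disjoint_ideal I && covering_ideal I) 'X^#|I|.
    rewrite coefS scaler_suml; apply: eq_big => [I|I /andP[_ /eqP->]]; last first.
      by rewrite scale1r.
    apply/andP/andP => -[dI h]; split=> //.
      by rewrite -middle_ideal //; exact/eqP.
    by rewrite eqn_leq disjoint_ideal_card // covering_ideal_card.
  have -> : B = \sum_(I | disjoint_ideal I && covering_ideal I) 'X^#|I| +
      \sum_(I | covering_ideal I && ~~ disjoint_ideal I) 'X^#|I|.
    rewrite /B (bigID disjoint_ideal) /=; congr (_ + _).
    by apply: eq_bigl => I; rewrite andbC.
  rewrite (eq_bigl _ _ ideal_cases) (bigID disjoint_ideal) /=.
  rewrite [in RHS]addrCA [RHS]addrC addKr; congr (_ + _); apply: eq_bigl => I;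
  by case: (disjoint_ideal I); case: (covering_ideal I).
apply: (@ideal_poly_core _ grade1 htn dual A B A`_half_card half_card (htn theta_root)).
- exact: htn_gt0.
- exact: dualK.
- exact: dual_grade1.
- exact: htn_dual.
- move=> i lt; apply: coef0 => I /disjoint_ideal_card le.
  by rewrite ltn_eqF // (leq_ltn_trans le).
- by [].
- move=> i lt; apply: coef0 => I /covering_ideal_card le.
  by rewrite gtn_eqF // (leq_trans lt).
- move=> i lt; apply: coef0 => I /covering_ideal_le le.
  by rewrite ltn_eqF // (leq_ltn_trans le).
- rewrite !coefS; apply: eq_bigl => I; apply: andb_id2r => /eqP cI.
  by rewrite middle_ideal.
- exact: half_card_lt.
apply: poly_eq_expR => k k0; have := coset_gen_fun_nat k0.
rewrite /A /B; set t := expR (2 * k) => E.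
pose ev := fun p : {poly int} => (map_poly intr p).[t].
have evD p q : ev (p + q) = ev p + ev q by rewrite /ev rmorphD hornerD.
have evM p q : ev (p * q) = ev p * ev q by rewrite /ev rmorphM hornerM.
have ev1B (i : nat) : ev (1 - 'X^i) = 1 - t ^+ i.
  by rewrite /ev rmorphB rmorph1 rmorphXn /= map_polyX hornerD hornerN hornerXn hornerC.
have evX : ev 'X = t by rewrite /ev map_polyX hornerX.
have ev_sum (p : pred {set T}) : ev (\sum_(I | p I) 'X^#|I|) = \sum_(I | p I) t ^+ #|I|.
  rewrite /ev rmorph_sum horner_sum; apply: eq_bigr => I _.
  by rewrite rmorphXn /= map_polyX hornerXn.
have ev_prod (h : T -> nat) : ev (\prod_(a in grade1) (1 - 'X^(h a))) =
    \prod_(a in grade1) (1 - t ^+ h a).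
  rewrite /ev rmorph_prod horner_prod; apply: eq_bigr => a _; exact: ev1B.
by rewrite -[LHS]/(ev _) -[RHS]/(ev _) !evM evD evM evX !ev_sum !ev1B
  ev_prod (ev_prod (fun a => (htn a).+1)).
Qed.

(** * Transfer to finite sets of vectors and to fractions *)

Lemma mem_grade j a : (rt a \in grade f D theta j) = (deg a == j).
Proof.
have aD : rt a \in D := valP a.
by rewrite in_fset inE /= aD -degE eqr_int.
Qed.

Lemma grade_sub j : {subset grade f D theta j <= D}.
Proof. by move=> v; rewrite in_fset inE => /andP[]. Qed.

Lemma grade_leP a b :
  grade_le f D P theta (rt a) (rt b) <-> ncomb levi_simples (rt b - rt a).
Proof.
have -> : levi_simples = [set c : T | rt c \in simple_grade f D P theta 0].
  by apply/setP => c; rewrite !inE mem_filter (mem_grade 0) andbC.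
apply: nat_combP; first exact: filter_uniq uniq_simples.
by move=> v; rewrite mem_filter => /andP[_ /(simple_root simpleP)].
Qed.

Definition root_fset I : {fset V} := [fset rt a | a in I].

Lemma mem_root_fset I a : (rt a \in root_fset I) = (a \in I).
Proof. by rewrite mem_imfset //; exact: rt_inj. Qed.

Lemma card_root_fset I : #|` root_fset I| = #|I|.
Proof. by rewrite card_imfset /= ?cardE //; exact: rt_inj. Qed.

Lemma root_fset_sub I : (root_fset I `<=` grade f D theta 1) = (I \subset grade1).
Proof.
apply/fsubsetP/subsetP => sub a; last first.
  by move=> /imfsetP[b /sub + ->]; rewrite inE (mem_grade 1).
by rewrite -mem_root_fset => /sub; rewrite (mem_grade 1) inE.
Qed.

Lemma upper_idealP I :
  upper_ideal (grade_le f D P theta) (grade f D theta 1) (root_fset I) <-> upper I.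
Proof.
rewrite /upper_ideal /upper root_fset_sub; split=> -[sub up]; split=> //.
  move=> a b aI b1 /grade_leP ab; rewrite -mem_root_fset.
  by apply: up ab; rewrite ?mem_root_fset // (mem_grade 1); rewrite inE in b1.
move=> u v /imfsetP[a aI ->] v1; have vD := grade_sub v1.
rewrite -[v]/(rt [` vD]) in v1 *; move=> /grade_leP ab.
by rewrite mem_root_fset; apply: up aI _ ab; rewrite inE -(mem_grade 1).
Qed.

Lemma ideal_polyE :
  ideal_poly (grade_le f D P theta) (grade f D theta 1) =
  \sum_(I | `[< upper I >]) 'X^#|I|.
Proof.
rewrite /ideal_poly (perm_big (map root_fset (enum (powerset grade1)))) /=; last first.
  apply: uniq_perm; first exact: fset_uniq.
    rewrite map_inj_in_uniq ?enum_uniq // => I J _ _ E.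
    by apply/setP => a; rewrite -!mem_root_fset E.
  move=> J; rewrite fpowersetE; apply/idP/mapP => [sub|[I]]; last first.
    by rewrite mem_enum powersetE => sub ->; rewrite root_fset_sub.
  have JE : J = root_fset [set a | rt a \in J].
    apply/fsetP => v; apply/idP/imfsetP => [vJ|[a + ->]]; last by rewrite inE.
    have vD : v \in D by move/fsubsetP: sub => /(_ _ vJ)/grade_sub.
    by exists [` vD]; rewrite ?inE.
  by exists [set a | rt a \in J] => //; rewrite mem_enum powersetE -root_fset_sub -JE.
rewrite big_map big_enum_cond /=; apply: eq_big => [I|I _]; last by rewrite card_root_fset.
rewrite powersetE; apply/andP/idP => [[_ /asboolP/upper_idealP/asboolP//]|/asboolP up].
by split; [case: up|apply/asboolP/upper_idealP].
Qed.

Lemma ideal_poly_formula : let t : {fraction {poly int}} := tofrac 'X in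
  tofrac (ideal_poly (grade_le f D P theta) (grade f D theta 1)) =
    \prod_(g <- grade f D theta 1)
      ((1 - t ^ (Defs.ht P g + 1)) / (1 - t ^ Defs.ht P g)).
Proof.
move=> t; rewrite ideal_polyE prodf_div.
have tE (m : nat) : 1 - t ^+ m = tofrac (1 - 'X^m).
  by rewrite rmorphB rmorph1 rmorphXn.
have prodE (F : V -> {fraction {poly int}}) :
    \prod_(g <- grade f D theta 1) F g = \prod_(a in grade1) F (rt a).
  rewrite big_roots ?fset_uniq //.
    by apply: eq_bigl => a; rewrite (mem_grade 1) inE.
  exact: grade_sub.
have htE' a : a \in grade1 -> Defs.ht P (rt a) = (htn a)%:Z.
  by rewrite inE => /eqP a1; case: (@htnP a) => //; rewrite pos_deg ?a1.
rewrite !prodE.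
have -> : \prod_(a in grade1) (1 - t ^ (Defs.ht P (rt a) + 1)) =
    tofrac (\prod_(a in grade1) (1 - 'X^((htn a).+1))).
  rewrite rmorph_prod; apply: eq_bigr => a a1.
  by rewrite htE' // -PoszD addn1; exact: tE.
have -> : \prod_(a in grade1) (1 - t ^ Defs.ht P (rt a)) =
    tofrac (\prod_(a in grade1) (1 - 'X^(htn a))).
  by rewrite rmorph_prod; apply: eq_bigr => a a1; rewrite htE' //; exact: tE.
rewrite -ideal_gen_fun rmorphM mulfK // tofrac_eq0.
by apply/prodf_neq0 => a a1; rewrite one_subXn_neq0 // htn_gt0.
Qed.
End HighestRoot.

Theorem theorem4p5 (R : realType) (V : vectType R) (f : {dot V for idfun})
    (D : {fset V}) (n : nat) (P : n.-tuple V) (theta : V)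
    (rootD : root_system f D) (irrD : irreducible_roots f D)
    (simpleP : simple_roots D P) (highest : highest_root D P theta) :
  let D1 := grade f D theta 1 in
  let t : {fraction {poly int}} := tofrac 'X in
  tofrac (ideal_poly (grade_le f D P theta) D1) =
    \prod_(g <- D1) ((1 - t ^ (ht P g + 1)) / (1 - t ^ ht P g)).
Proof. exact: (ideal_poly_formula rootD simpleP highest). Qed.
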